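(* Let $(\mathfrak{g},\circ)$ be a non-abelian bi-nilpotent Lie algebra. Then $\mathfrak{g}$ admits a scalar product $\langle\cdot,\cdot\rangle$ making $(\mathfrak{g},\circ,\langle\cdot,\cdot\rangle)$ a weakly flat Lorentzian $F$-Lie algebra such that $\mathbb{R}\hat a$ is a two-sided ideal of $(\mathfrak{g},\circ)$ for some non-zero $\hat a\in N(\mathfrak{g})\cap Z(\mathfrak{g})$ with $\langle\hat a,\hat a\rangle=0$, if and only if $(\mathfrak{g},\circ)$ is obtained (up to isomorphism) as a double extension of a weakly flat Riemannian $F$-Lie algebra $(B,\underline{\circ},\langle\cdot,\cdot\rangle')$, with $B$ abelian and $(B,\underline{\circ})$ bi-nilpotent, with respect to parameters $(\mu,\lambda,\beta,a_0,b_0,u,D,v)=(0,0,\beta,a_0,b_0,D,D,v)$ where $D^2=0$ and $\mathrm{im}(D)\subset(\mathbb{R}b_0)^\perp$. Moreover, $v$ is always nilpotent.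
   Context: All Lie algebras and vector spaces are real and finite-dimensional. A scalar product is a non-degenerate symmetric bilinear form; it is Riemannian if positive definite and Lorentzian if of signature $(1,n-1)$. For a Lie algebra $\mathfrak{g}$ with scalar product $\langle\cdot,\cdot\rangle$, the Levi-Civita product $\ast$ is the unique bilinear product with $[x,y]=x\ast y-y\ast x$ and $\langle x\ast y,z\rangle+\langle y,x\ast z\rangle=0$. The scalar product is flat if $\ast$ is left-symmetric: $(x\ast y)\ast z-x\ast(y\ast z)=(y\ast x)\ast z-y\ast(x\ast z)$. $N(\mathfrak{g})=\{x\in\mathfrak{g}: x\ast y=0\ \forall y\in\mathfrak{g}\}$ and $Z(\mathfrak{g})$ is the center of the Lie algebra $\mathfrak{g}$. A bi-nilpotent Lie algebra is a pair $(\mathfrak{g},\circ)$ with $\mathfrak{g}$ a nilpotent Lie algebra and $\circ$ a commutative associative bilinear product on $\mathfrak{g}$ such that $y\mapsto x\circ y$ is a nilpotent linear map for every $x\in\mathfrak{g}$. A weakly flat pseudo-Riemannian (Riemannian, Lorentzian) $F$-Lie algebra $(\mathfrak{g},\circ,\langle\cdot,\cdot\rangle)$ is a Lie algebra $\mathfrak{g}$ with a flat scalar product (Riemannian, Lorentzian respectively) and an associative commutative bilinear product $\circ$ (no unit required) satisfying $\langle x\circ y,z\rangle=\langle x,y\circ z\rangle$ and the Hertling-Manin relation, for all $x,y,z,w$: $$[x\circ y,z\circ w]-[x\circ y,z]\circ w-[x\circ y,w]\circ z-x\circ[y,z\circ w]+x\circ[y,z]\circ w+x\circ[y,w]\circ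 z-y\circ[x,z\circ w]+y\circ[x,z]\circ w+y\circ[x,w]\circ z=0.$$ Double extension. Let $(B,\underline{\circ},\langle\cdot,\cdot\rangle')$ be a weakly flat pseudo-Riemannian $F$-Lie algebra with bracket $[\cdot,\cdot]_B$ and Levi-Civita product $\underline{\ast}$. For a linear map $s$ of $B$, $s^\ast$ is its adjoint for $\langle\cdot,\cdot\rangle'$; $R_s(x)=x\underline{\ast}s$; $r_s(x)=x\underline{\circ}s$; $\mathrm{ad}_s(x)=[s,x]_B$; $\widetilde{\mathrm{ad}}_s(x)=\mathrm{ad}_x^\ast(s)$; brackets of linear maps are commutators. The parameters $(\mu,\lambda,\beta,a_0,b_0,u,D,v)$ consist of $\mu,\lambda,\beta\in\mathbb{R}$, $a_0,b_0\in B$, a linear $u:B\to B$ with $u([x,y]_B)=x\underline{\ast}u(y)-y\underline{\ast}u(x)$, a derivation $D$ of the Lie algebra $B$, and a linear $v:B\to B$ with $v(x\underline{\circ}y)=v(x)\underline{\circ}y$, such that $(D-u)^\ast=-(D-u)$, $v^\ast=v$, and for all $x,y,z\in B$: $$[D,u]=u^2-\mu u-R_{b_0},$$ $$x\underline{\ast}u(y)-u(x\underline{\ast}y)=D(x)\underline{\ast}y+x\underline{\ast}D(y)-D(x\underline{\ast}y),$$ $$v^2=\lambda v+r_{a_0},$$ $$-\lambda\mu a_0+\lambda v(b_0)+v((u-u^\ast)(a_0))+v(D(a_0))-\lambda(u-u^\ast)(a_0)-\mathrm{ad}^\ast_{a_0}(a_0)-\lambda^2b_0+\lambda D^\ast(a_0)-2v(D^\ast(a_0))+2D^\ast(v(a_0))=0,$$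 $$[\mathrm{ad}_{a_0},v]+\lambda[D,v]+2[v,vD]+r_{D(a_0)}=0,$$ $$\lambda\mu v-r_{(u-u^\ast)(a_0)}-\lambda r_{b_0}+2r_{D^\ast(a_0)}-\lambda D^\ast v-2D^\ast r_{a_0}+\mathrm{ad}^\ast_{a_0}v+v\,\mathrm{ad}_{a_0}-\lambda vD-2r_{a_0}D=0,$$ $$[x\underline{\circ}y,a_0]_B-x\underline{\circ}[y,a_0]_B-y\underline{\circ}[x,a_0]_B+(2v-\lambda\,\mathrm{id}_B)\big(D(x\underline{\circ}y)-x\underline{\circ}D(y)-y\underline{\circ}D(x)\big)=0,$$ $$v(u-u^\ast+D-D^\ast)v-\lambda\big(v(u-u^\ast)+(u-u^\ast)v\big)+\lambda(D^\ast v-vD)+D^\ast r_{a_0}-r_{a_0}D+\lambda^2(u-u^\ast)+\lambda\widetilde{\mathrm{ad}}_{a_0}-(\widetilde{\mathrm{ad}}_{a_0}v+v\widetilde{\mathrm{ad}}_{a_0})+\widetilde{\mathrm{ad}}_{v(a_0)}=0,$$ $$v\big(v([x,y]_B)-[v(x),y]_B-[x,v(y)]_B\big)+v(x\underline{\circ}D(y)-y\underline{\circ}D(x))+D(v(x))\underline{\circ}y-D(v(y))\underline{\circ}x+[v(x),v(y)]_B=0,$$ $$(v-\lambda\,\mathrm{id}_B)((u-u^\ast)(x\underline{\circ}y))+v(D(x\underline{\circ}y)-x\underline{\circ}D(y)-y\underline{\circ}D(x))+(\lambda\,\mathrm{id}_B-v)(\mathrm{ad}_x^\ast(v(y))+\mathrm{ad}_y^\ast(v(x)))-\mathrm{ad}^\ast_{x\underline{\circ}y}(a_0)+\mathrm{ad}^\ast_x(a_0\underline{\circ}y)+\mathrm{ad}^\ast_y(a_0\underline{\circ}x)=0,$$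 $$[x\underline{\circ}y,v(z)]_B-x\underline{\circ}[y,v(z)]_B-y\underline{\circ}[x,v(z)]_B+D(x\underline{\circ}y)\underline{\circ}z-(x\underline{\circ}D(y))\underline{\circ}z-(y\underline{\circ}D(x))\underline{\circ}z-v\big([x\underline{\circ}y,z]_B-x\underline{\circ}[y,z]_B-y\underline{\circ}[x,z]_B\big)=0,$$ $$(u-u^\ast)(x\underline{\circ}y)\underline{\circ}z-v\big([x\underline{\circ}y,z]_B-x\underline{\circ}[y,z]_B-y\underline{\circ}[x,z]_B\big)-\mathrm{ad}^\ast_{x\underline{\circ}y}(v(z))-\mathrm{ad}^\ast_x(v(y))\underline{\circ}z-\mathrm{ad}^\ast_y(v(x))\underline{\circ}z+\mathrm{ad}^\ast_x(y\underline{\circ}v(z))+\mathrm{ad}^\ast_y(x\underline{\circ}v(z))=0.$$ The double extension of $B$ with respect to these parameters is $\mathfrak{g}=\mathbb{R}a\oplus B\oplus\mathbb{R}d$ with: the scalar product extending $\langle\cdot,\cdot\rangle'$ with $\langle a,a\rangle=\langle d,d\rangle=0$, $\langle a,d\rangle=1$, $\mathbb{R}a\oplus\mathbb{R}d\perp B$; the Lie bracket $[d,a]=\mu a$, $[d,x]=-\langle b_0,x\rangle'a+D(x)$, $[x,y]=\langle(u-u^\ast)(x),y\rangle'a+[x,y]_B$, $[a,x]=0$; and the commutative product $a\circ a=a\circ x=0$, $x\circ y=\langle v(x),y\rangle'a+x\underline{\circ}y$, $a\circ d=\lambda a$, $d\circ d=\beta a+a_0+\lambda d$, $d\circ x=\langle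 a_0,x\rangle'a+v(x)$ ($x,y\in B$). It is a weakly flat pseudo-Riemannian $F$-Lie algebra; here the line $\mathbb{R}\hat a$ corresponds to $\mathbb{R}a$. *)

(* Defs.v *)
From HB Require Import structures.
From mathcomp Require Import all_boot all_order all_algebra sesquilinear.
From mathcomp Require Import all_classical all_reals lra.

Set Implicit Arguments.
Unset Strict Implicit.
Unset Printing Implicit Defensive.

Import Order.TTheory GRing.Theory Num.Theory.
Local Open Scope classical_set_scope.
Local Open Scope ring_scope.

Definition nilpotent_map (R : realType) (V : vectType R) (f : V -> V) : Prop :=
  exists k : nat, forall x, iter k f x = 0.

Section LieAlgebra.
Variables (R : realType) (g : vectType R).
Implicit Types (br pr : {bilinear g -> g -> g}) (form : {symmetric g}).

Record is_lie_algebra br : Prop := IsLieAlgebra {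
  lie_alternating : forall x, br x x = 0;
  lie_jacobi : forall x y z, br x (br y z) + br y (br z x) + br z (br x y) = 0 }.

Definition is_abelian br : Prop := forall x y, br x y = 0.

Definition lie_center br : set g := [set x | forall y, br x y = 0].

(* Since [br] is bilinear, the brackets of basis vectors span [g, C^k]. *)
Fixpoint lower_central br (k : nat) : {vspace g} :=
  if k is j.+1 then
    <<[seq br x y | x <- vbasis {:g}, y <- vbasis (lower_central br j)]>>%VS
  else fullv.

Definition is_nilpotent_lie br : Prop :=
  exists k : nat, lower_central br k = 0%VS.

Record is_comm_assoc pr : Prop := IsCommAssoc {
  prod_comm : forall x y, pr x y = pr y x;
  prod_assoc : forall x y z, pr (pr x y) z = pr x (pr y z) }.

Record bi_nilpotent br pr : Prop := BiNilpotent {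
  bn_lie : is_lie_algebra br;
  bn_lie_nilpotent : is_nilpotent_lie br;
  bn_prod : is_comm_assoc pr;
  bn_mul_nilpotent : forall x, nilpotent_map (pr x) }.

Definition two_sided_ideal pr (I : {vspace g}) : Prop :=
  forall x y, y \in I -> pr x y \in I /\ pr y x \in I.

Definition riemannian form : Prop := forall x, x != 0 -> 0 < form x x.

(* The first entry of the signature counts the negative squares, so that the
   double extension of a Riemannian algebra is Lorentzian. *)
Definition has_signature form (p q : nat) : Prop :=
  exists e : (p + q).-tuple g,
    [/\ basis_of fullv e,
        forall i j, i != j -> form (tnth e i) (tnth e j) = 0,
        forall i : 'I_(p + q), (i < p)%N -> form (tnth e i) (tnth e i) < 0 &
        forall i : 'I_(p + q), (p <= i)%N -> 0 < form (tnth e i) (tnth e i)].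

Definition lorentzian form : Prop := has_signature form 1 (\dim {:g}).-1.

Definition form_orth form (A : set g) : set g :=
  [set y | forall x, A x -> form x y = 0].

Record is_levi_civita br form (m : g -> g -> g) : Prop := IsLeviCivita {
  lc_linear_l : forall y, linear (m^~ y);
  lc_linear_r : forall x, linear (m x);
  lc_torsion_free : forall x y, br x y = m x y - m y x;
  lc_metric : forall x y z, form (m x y) z + form y (m x z) = 0 }.

(* See [levi_civitaP] and [levi_civita_unique]. *)
Definition levi_civita br form : g -> g -> g :=
  xget (fun _ _ => 0) [set m | is_levi_civita br form m].

(* See [adjointP] and [adjoint_unique]. *)
Definition adjoint form (f : g -> g) : 'End(g) :=
  xget 0 [set h : 'End(g) | forall x y, form (f x) y = form x (h y)].

Definition left_symmetric (m : g -> g -> g) : Prop :=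
  forall x y z, m (m x y) z - m x (m y z) = m (m y x) z - m y (m x z).

Definition flat br form : Prop := left_symmetric (levi_civita br form).

Definition lc_kernel br form : set g :=
  [set x | forall y, levi_civita br form x y = 0].

Definition hertling_manin br pr : Prop := forall x y z w,
  br (pr x y) (pr z w) - pr (br (pr x y) z) w - pr (br (pr x y) w) z
  - pr x (br y (pr z w)) + pr (pr x (br y z)) w + pr (pr x (br y w)) z
  - pr y (br x (pr z w)) + pr (pr y (br x z)) w + pr (pr y (br x w)) z = 0.

Record weakly_flat_F_lie br pr form : Prop := WeaklyFlatFLie {
  wf_lie : is_lie_algebra br;
  wf_nondegenerate : nondegenerate form;
  wf_flat : flat br form;
  wf_prod : is_comm_assoc pr;
  wf_invariant : forall x y z, form (pr x y) z = form x (pr y z);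
  wf_hertling_manin : hertling_manin br pr }.

Definition weakly_flat_riemannian_F_lie br pr form : Prop :=
  weakly_flat_F_lie br pr form /\ riemannian form.

Definition weakly_flat_lorentzian_F_lie br pr form : Prop :=
  weakly_flat_F_lie br pr form /\ lorentzian form.

Section WellDefined.
Variables (form : {symmetric g}) (form_nd : nondegenerate form).

Lemma form_sym x y : form x y = form y x.
Proof. by rewrite hermC /= expr0 mul1r. Qed.

Lemma nondegenerateE x : (forall y, form x y = 0) -> x = 0.
Proof.
move=> hx; apply/eqP; rewrite -memv0; move/eqP: form_nd => <-.
by apply/mem_orthovP => y _; exact: hx.
Qed.

Lemma form_inj x y : (forall z, form x z = form y z) -> x = y.
Proof.
move=> h; apply/subr0_eq/nondegenerateE => z.
by rewrite linearBl /= h subrr.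
Qed.

Definition form_lfun (x : g) : 'Hom(g, R^o) := linfun (form x : g -> R^o).

Lemma form_lfunE x y : form_lfun x y = form x y.
Proof. by rewrite lfunE. Qed.

Fact form_lfun_linear : linear form_lfun.
Proof.
move=> c x y; apply/lfunP => z.
by rewrite add_lfunE scale_lfunE !form_lfunE linearPl.
Qed.
HB.instance Definition _ :=
  GRing.isLinear.Build R g 'Hom(g, R^o) *:%R form_lfun form_lfun_linear.

Lemma form_represent (f : g -> R) : (forall c x y, f (c *: x + y) = c * f x + f y) ->
  exists z, forall y, f y = form z y.
Proof.
move=> f_lin.
have f_lin' : linear (f : g -> R^o) by exact: f_lin.
pose fm := HB.pack_for {linear g -> R^o} (f : g -> R^o)
  (GRing.isLinear.Build R g R^o *:%R (f : g -> R^o) f_lin').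
pose Phi : 'Hom(g, 'Hom(g, R^o)) := linfun form_lfun.
have ker0 : lker Phi == 0%VS.
  apply/lker0P => x y; rewrite !lfunE /= => /lfunP exy.
  by apply: form_inj => z; have := exy z; rewrite /= /form_lfun !lfunE.
have imf : limg Phi = fullv.
  apply/eqP; rewrite eqEdim subvf limg_dim_eq; last first.
    by rewrite (eqP ker0) capv0.
  by rewrite !dimvf /dim /= /dim /= muln1.
have : linfun fm \in limg Phi by rewrite imf memvf.
case/memv_imgP => z _ ez; exists z => y.
have /lfunP /(_ y) := ez.
by rewrite !lfunE /= => ->; rewrite /form_lfun ?lfunE.
Qed.

Lemma adjointP (f : {linear g -> g}) x y : form (f x) y = form x (adjoint form f y).
Proof.
suff [h hP] : exists h : 'End(g), forall x y, form (f x) y = form x (h y).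
  pose P := [set h : 'End(g) | forall x y, form (f x) y = form x (h y)].
  by have := @xgetPex _ 0 P (ex_intro _ h hP); apply.
have /choice[h hP] : forall y, exists z, forall x, form (f x) y = form z x.
  move=> {}y; apply: form_represent => c a b.
  by rewrite linearP linearPl.
have h_lin : linear h.
  move=> c a b; apply: form_inj => z.
  by rewrite linearPl -!hP linearPr /= !hP.
pose hm := HB.pack_for {linear g -> g} h (GRing.isLinear.Build R g g *:%R h h_lin).
exists (linfun hm) => a b.
by rewrite lfunE /= hP form_sym.
Qed.

Lemma adjoint_unique (f : {linear g -> g}) (h : g -> g) :
  (forall x y, form (f x) y = form x (h y)) -> adjoint form f =1 h.
Proof.
move=> hP y; apply: form_inj => x.
by rewrite ![form _ x]form_sym -hP -adjointP.
Qed.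

Lemma levi_civita_koszul br m : is_levi_civita br form m -> forall x y z,
  form (m x y) z = 2^-1 * (form (br x y) z + form (br z x) y + form (br z y) x).
Proof.
move=> [_ _ tf mt] x y z.
rewrite !tf !linearBl /=.
have := mt x y z; have := mt x z y; have := mt y x z; have := mt y z x.
have := mt z x y; have := mt z y x.
have S a b c : form c (m a b) = form (m a b) c by exact: form_sym.
rewrite !S; lra.
Qed.

Lemma levi_civita_unique br m m' :
  is_levi_civita br form m -> is_levi_civita br form m' -> m = m'.
Proof.
move=> hm hm'; apply/funext => x; apply/funext => y; apply: form_inj => z.
by rewrite (levi_civita_koszul hm) (levi_civita_koszul hm').
Qed.

Lemma levi_civitaP br :
  is_lie_algebra br -> is_levi_civita br form (levi_civita br form).
Proof.
move=> hbr.
suff [m hm] : exists m, is_levi_civita br form m.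
  exact: (@xgetPex _ _ [set m | is_levi_civita br form m] (ex_intro _ m hm)).
have brC x y : br x y = - br y x.
  have := lie_alternating hbr (x + y).
  rewrite linearDl !linearDr /= !(lie_alternating hbr) add0r addr0.
  by move/eqP; rewrite addr_eq0 => /eqP.
have /choice[m0 m0P] : forall p : g * g, exists w, forall z,
    2^-1 * (form (br p.1 p.2) z + form (br z p.1) p.2 + form (br z p.2) p.1)
    = form w z.
  move=> [x y] /=; apply: form_represent => c a b.
  by rewrite !(linearPl, linearPr) /=; lra.
have mP x y z := m0P (x, y) z; rewrite /= in mP.
exists (fun x y => m0 (x, y)); split => [y c a b|x c a b|x y|x y z].
- apply: form_inj => z; rewrite linearPl -!mP !(linearPl, linearPr) /= -!mP; lra.
- apply: form_inj => z; rewrite linearPl -!mP !(linearPl, linearPr) /= -!mP; lra.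
- apply: form_inj => z; rewrite linearBl /= -!mP (brC y x) linearNl /= -?mP; lra.
- rewrite [form y _]form_sym -!mP (brC z x) (brC y x) (brC z y).
  by rewrite !linearNl /= -?mP; lra.
Qed.

End WellDefined.
End LieAlgebra.

Section DoubleExtension.
Variables (R : realType) (B : vectType R).

Record dext_param := DextParam {
  dp_mu : R; dp_lambda : R; dp_beta : R;
  dp_a0 : B; dp_b0 : B;
  dp_u : {linear B -> B}; dp_D : {linear B -> B}; dp_v : {linear B -> B} }.

Definition commutator (f h : B -> B) : B -> B := fun x => f (h x) - h (f x).

Variables (br pr : {bilinear B -> B -> B}) (form : {symmetric B}).
Variable p : dext_param.

Local Notation mu := (dp_mu p).
Local Notation lambda := (dp_lambda p).
Local Notation beta := (dp_beta p).
Local Notation a0 := (dp_a0 p).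
Local Notation b0 := (dp_b0 p).
Local Notation u := (dp_u p).
Local Notation D := (dp_D p).
Local Notation v := (dp_v p).
Local Notation lc := (levi_civita br form).
Local Notation adj := (adjoint form).
Local Notation us := (adj u).
Local Notation Ds := (adj D).
Local Notation ad := (br : B -> B -> B).
Local Notation ads x := (adj (ad x)).
Local Notation adt s := (fun x : B => ads x s).
Local Notation r s := (fun x : B => pr x s).
Local Notation uus := (fun x : B => u x - us x).

Record dext_admissible : Prop := DextAdmissible {
  da_u : forall x y, u (br x y) = lc x (u y) - lc y (u x);
  da_D : forall x y, D (br x y) = br (D x) y + br x (D y);
  da_v : forall x y, v (pr x y) = pr (v x) y;
  da_Du_skew : forall x, adj (fun y => D y - u y) x = - (D x - u x);
  da_v_selfadjoint : forall x, adj v x = v x;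
  da_commDu : forall x, commutator D u x = u (u x) - mu *: u x - lc x b0;
  da_lcu : forall x y,
    lc x (u y) - u (lc x y) = lc (D x) y + lc x (D y) - D (lc x y);
  da_v2 : forall x, v (v x) = lambda *: v x + r a0 x;
  da_a0b0 :
    - (lambda * mu) *: a0 + lambda *: v b0 + v (uus a0) + v (D a0)
    - lambda *: uus a0 - ads a0 a0 - lambda ^+ 2 *: b0 + lambda *: Ds a0
    - 2 *: v (Ds a0) + 2 *: Ds (v a0) = 0;
  da_comm_v : forall x,
    commutator (ad a0) v x + lambda *: commutator D v x
    + 2 *: commutator v (v \o D) x + r (D a0) x = 0;
  da_lambda_mu_v : forall x,
    (lambda * mu) *: v x - r (uus a0) x - lambda *: r b0 x
    + 2 *: r (Ds a0) x - lambda *: Ds (v x) - 2 *: Ds (r a0 x)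
    + ads a0 (v x) + v (ad a0 x) - lambda *: v (D x) - 2 *: r a0 (D x) = 0;
  da_br_a0 : forall x y,
    let w := D (pr x y) - pr x (D y) - pr y (D x) in
    br (pr x y) a0 - pr x (br y a0) - pr y (br x a0)
    + (2 *: v w - lambda *: w) = 0;
  da_skew : forall x,
    v (uus (v x) + D (v x) - Ds (v x))
    - lambda *: (v (uus x) + uus (v x)) + lambda *: (Ds (v x) - v (D x))
    + Ds (r a0 x) - r a0 (D x) + lambda ^+ 2 *: uus x + lambda *: adt a0 x
    - (adt a0 (v x) + v (adt a0 x)) + adt (v a0) x = 0;
  da_br_v : forall x y,
    v (v (br x y) - br (v x) y - br x (v y))
    + v (pr x (D y) - pr y (D x))
    + pr (D (v x)) y - pr (D (v y)) x + br (v x) (v y) = 0;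
  da_uus_prod : forall x y,
    let w := ads x (v y) + ads y (v x) in
    (v (uus (pr x y)) - lambda *: uus (pr x y))
    + v (D (pr x y) - pr x (D y) - pr y (D x))
    + (lambda *: w - v w)
    - ads (pr x y) a0 + ads x (pr a0 y) + ads y (pr a0 x) = 0;
  da_D_prod : forall x y z,
    br (pr x y) (v z) - pr x (br y (v z)) - pr y (br x (v z))
    + pr (D (pr x y)) z - pr (pr x (D y)) z - pr (pr y (D x)) z
    - v (br (pr x y) z - pr x (br y z) - pr y (br x z)) = 0;
  da_uus_prod3 : forall x y z,
    pr (uus (pr x y)) z - v (br (pr x y) z - pr x (br y z) - pr y (br x z))
    - ads (pr x y) (v z) - pr (ads x (v y)) z - pr (ads y (v x)) z
    + ads x (pr y (v z)) + ads y (pr x (v z)) = 0 }.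

(* The triple (s, x, t) stands for s a + x + t d. *)
Definition dext : vectType R := (R^o * B * R^o)%type.

Definition dext_form (X Y : dext) : R :=
  let: (s, x, t) := X in let: (s', x', t') := Y in
  s * t' + t * s' + form x x'.

Definition dext_br (X Y : dext) : dext :=
  let: (s, x, t) := X in let: (s', x', t') := Y in
  (mu * (t * s' - t' * s) - t * form b0 x' + t' * form b0 x + form (uus x) x',
   t *: D x' - t' *: D x + br x x',
   0).

Definition dext_pr (X Y : dext) : dext :=
  let: (s, x, t) := X in let: (s', x', t') := Y in
  (lambda * (s * t' + t * s') + beta * (t * t')
     + t * form a0 x' + t' * form a0 x + form (v x) x',
   (t * t') *: a0 + t *: v x' + t' *: v x + pr x x',
   lambda * (t * t')).

End DoubleExtension.

Definition bracket_product_iso (R : realType) (g h : vectType R)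
    (br pr : g -> g -> g) (br' pr' : h -> h -> h) : Prop :=
  exists2 phi : {linear g -> h}, bijective phi &
    forall x y, phi (br x y) = br' (phi x) (phi y)
             /\ phi (pr x y) = pr' (phi x) (phi y).

(* [(g, br, pr)] is isomorphic to the double extension of
   [(B, brB, prB, formB)] with parameters (0, 0, beta, a0, b0, D, D, v). *)
Record is_special_dext (R : realType)
    (g : vectType R) (br pr : {bilinear g -> g -> g})
    (B : vectType R) (brB prB : {bilinear B -> B -> B}) (formB : {symmetric B})
    (beta : R) (a0 b0 : B) (D v : {linear B -> B}) : Prop := IsSpecialDext {
  sd_base : weakly_flat_riemannian_F_lie brB prB formB;
  sd_abelian : is_abelian brB;
  sd_bi_nilpotent : bi_nilpotent brB prB;
  sd_admissible :
    dext_admissible brB prB formB (DextParam 0 0 beta a0 b0 D D v);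
  sd_D2 : forall x, D (D x) = 0;
  sd_imD : range D `<=` form_orth formB [set` <[b0]>%VS];
  sd_iso :
    let p := DextParam 0 0 beta a0 b0 D D v in
    bracket_product_iso br pr (dext_br brB formB p) (dext_pr prB formB p) }.

(* Main.v *)
(* Write * for the Levi-Civita product and put h = ahat^perp, which modulo
   R ahat is a Euclidean space B.  Since ahat lies in N(g) and in the center, B
   inherits a nilpotent Lie algebra structure with flat definite metric, which is
   abelian: if z = [x, y] is central modulo ahat, flatness gives z * (z * w) = 0,
   so z * w = 0 by skewness and z is orthogonal to [h, h], hence to itself.
   Next choose d null with <ahat, d> = 1, and on B let S = d * _, u = - (_ * d),
   D = [d, _] = S + u.  Flatness reads u D = S u, so u D^k = S^k u, and as D is
   nilpotent and S skew, first S u = 0, then S = 0; thus u = D and D^2 = 0.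
   Replacing d by d + b changes b0 = d * d into b0 - D b, so an orthogonal
   projection makes b0 orthogonal to im D.
   What remains are the conditions on the product: evaluated on B and d, the
   Hertling-Manin tensor has nine kinds of entries, whose ahat- and B-components
   are exactly the nontrivial admissibility conditions, which proves both
   implications. *)
Require Import Defs.
From HB Require Import structures.
From mathcomp Require Import all_boot all_order all_algebra sesquilinear.
From mathcomp Require Import all_classical all_reals ring lra.

Set Implicit Arguments.
Unset Strict Implicit.
Unset Printing Implicit Defensive.

Import Order.TTheory GRing.Theory Num.Theory.
Local Open Scope classical_set_scope.
Local Open Scope ring_scope.

(** * Deciding linear identities through scalar functionals *)

Section Functionals.
Variables (R : realType) (V : vectType R).

(** The coordinates in a basis already separate vectors. This turns an identity between vectors into
    one between scalars, which [ring] can decide; [module_ring] below rests on it. *)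
Lemma functional_eq (x y : V) : (forall f : {scalar V}, f x = f y) -> x = y.
Proof.
move=> h; rewrite (coord_vbasis (memvf x)) (coord_vbasis (memvf y)).
by apply: eq_bigr => i _; congr (_ *: _); apply: (h (coord (vbasis fullv) i)).
Qed.

End Functionals.

Definition linE := (linearDl, linearDr, linearBl, linearBr, linearNl, linearNr,
  linearZl_LR, linearZr_LR, linear0l, linear0r).

Ltac module_ring :=
  apply: functional_eq => ?; rewrite ?(linearD, linearB, linearN, linearZ, linear0) /=; ring.

(** * Nilpotency *)

Section LowerCentral.
Variables (R : realType) (g : vectType R) (br : {bilinear g -> g -> g}).

(** The series is generated by brackets of basis vectors only; bilinear expansion in both bases
    recovers all brackets. *)
Lemma mem_lower_central k x y :
  y \in lower_central br k -> br x y \in lower_central br k.+1.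
Proof.
move=> yk; rewrite (coord_vbasis (memvf x)) (coord_vbasis yk) linear_sumlz.
apply: memv_suml => i _; rewrite linear_sumr; apply: memv_suml => j _.
rewrite linearZl_LR linearZr_LR; do 2!apply: memvZ; apply: memv_span.
by apply/allpairsP; exists ((vbasis {:g})`_i, (vbasis (lower_central br k))`_j);
  split=> //=; apply: mem_nth; rewrite size_tuple.
Qed.

Lemma iter_br_lower_central k x y : iter k (br x) y \in lower_central br k.
Proof.
by elim: k => [|k IH]; [exact: memvf | exact: mem_lower_central IH].
Qed.

Hypothesis br_nil : is_nilpotent_lie br.

Lemma ad_nilpotent : exists k, forall x y, iter k (br x) y = 0.
Proof.
have [k hk] := br_nil; exists k => x y.
by apply/eqP; rewrite -memv0 -hk iter_br_lower_central.
Qed.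

(* Descending induction along the lower central series of the subalgebra
   [H]: [P] holds on its last terms, and propagates backwards. *)
Lemma nilpotent_bracket_ind (H P : g -> Prop) :
  P 0 -> (forall x y, H x -> H y -> H (br x y)) ->
  (forall x y, H x -> H y -> (forall w, H w -> P (br w (br x y))) -> P (br x y)) ->
  forall x y, H x -> H y -> P (br x y).
Proof.
move=> P0 Hbr step; have [k hk] := br_nil.
suff IH j x y : H x -> H y -> y \in lower_central br (k - j) -> P (br x y).
  by move=> x y Hx Hy; apply: (IH k) => //; rewrite subnn memvf.
elim: j x y => [|j IH] x y Hx Hy yj.
  by move: yj; rewrite subn0 hk memv0 => /eqP ->; rewrite linear0r.
apply: step => // w Hw; apply: IH => //; first exact: Hbr.
(* For [k <= j] the truncated difference [k - j] is 0, and that term of the series is the whole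
   algebra. *)
case: (ltnP j k) => jk; last first.
  have -> : (k - j = 0)%N by apply/eqP; rewrite subn_eq0.
  exact: memvf.
by rewrite -(subnSK jk); exact: mem_lower_central.
Qed.

End LowerCentral.

(** * Orthogonal projection *)

Section Projection.
Variables (R : realType) (g : vectType R) (form : {symmetric g}).

(** Gram-Schmidt for a form that may degenerate on [H]: an isotropic vector met on the way lies in
    the radical of [H] and imposes no condition. This is needed for [H] the orthogonal of a null
    vector, where the form is only semidefinite. *)
Lemma orthogonal_projection (H : {vspace g}) (X : seq g) (y : g) :
  (forall z w, z \in H -> w \in H -> form z z = 0 -> form z w = 0) ->
  {subset X <= H} -> y \in H ->
  exists2 w, w \in <<X>>%VS & forall z, z \in <<X>>%VS -> form (y - w) z = 0.
Proof.
move=> rad; elim: X y => [|x X IH] y XH yH.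
  exists 0; rewrite ?mem0v // => z; rewrite span_nil memv0 => /eqP->.
  by rewrite linear0r.
have xH : x \in H by apply: XH; rewrite inE eqxx.
have sXH : {subset X <= H} by move=> z zX; apply: XH; rewrite inE zX orbT.
have XHs : (<<X>> <= H)%VS by apply/span_subvP.
have [p pX hp] := IH x sXH xH; have [q qX hq] := IH y sXH yH.
have pH := subvP XHs _ pX; have qH := subvP XHs _ qX.
pose x' := x - p; have x'H : x' \in H by rewrite rpredB.
have mem_line c w : w \in <<X>>%VS -> c *: x + w \in <<x :: X>>%VS.
  move=> wX; rewrite span_cons; apply: memv_add => //; apply: memvZ; exact: memv_line.
pose c := form y x' / form x' x'.
exists (q + c *: x').
  have -> : q + c *: x' = c *: x + (q - c *: p) by rewrite /x'; module_ring.
  by apply: mem_line; rewrite rpredB // memvZ.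
(* If [x'] is isotropic, [rad] gives the claim whatever [c] is; otherwise [c] is the usual
   projection coefficient. *)
have key : form (y - (q + c *: x')) x' = 0.
  have qx' : form q x' = 0 by rewrite form_sym hp.
  case: (eqVneq (form x' x') 0) => e.
    rewrite form_sym; apply: rad => //.
    by rewrite rpredB // rpredD // memvZ.
  by rewrite linearBl linearDl linearZl_LR /= qx' add0r /c divfK // subrr.
move=> z; rewrite span_cons => /memv_addP [_ /vlineP[k ->]] [w wX ->].
have -> : k *: x + w = k *: x' + (w + k *: p) by rewrite /x'; module_ring.
have wpX : w + k *: p \in <<X>>%VS by rewrite rpredD // memvZ.
rewrite linearDr linearZr_LR /= key mulr0 add0r opprD addrA linearBl /=.
by rewrite hq // linearZl_LR /= hp // mulr0 subr0.
Qed.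

(** Keeping both the length and the span ensures that a basis is turned into a basis. *)
Lemma gram_schmidt (X : seq g) : (forall z, form z z = 0 -> z = 0) ->
  exists Y : seq g, [/\ size Y = size X, <<Y>>%VS = <<X>>%VS &
    forall i j, (i < size Y)%N -> (j < size Y)%N -> i != j -> form Y`_i Y`_j = 0].
Proof.
move=> aniso; elim: X => [|x X [Y [sY spY oY]]]; first by exists [::].
have rad z w : z \in fullv -> w \in fullv -> form z z = 0 -> form z w = 0.
  by move=> _ _ /aniso ->; rewrite linear0l.
have [p pX hp] :=
  orthogonal_projection rad (fun z (_ : z \in X) => memvf z) (memvf x).
exists (x - p :: Y); split => /=; first by rewrite sY.
  rewrite !span_cons spY; apply/eqP; rewrite eqEsubv.
  apply/andP; split; apply/subvP => z /memv_addP [_ /vlineP[k ->]] [w wX ->].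
    have -> : k *: (x - p) + w = k *: x + (w - k *: p) by module_ring.
    by apply: memv_add; rewrite ?memvZ ?memv_line ?rpredB ?memvZ.
  have -> : k *: x + w = k *: (x - p) + (w + k *: p) by module_ring.
  by apply: memv_add; rewrite ?memvZ ?memv_line ?rpredD ?memvZ.
have orth i : (i < size Y)%N -> form (x - p) Y`_i = 0.
  by move=> iY; apply: hp; rewrite -spY memv_span // mem_nth.
case=> [|i] [|j] //= iY jY ij; first exact: orth.
- by rewrite form_sym; exact: orth.
- exact: oY.
Qed.

End Projection.

(** * Flat nilpotent Lorentzian Lie algebras *)

Section Lorentzian.
Variables (R : realType) (g : vectType R) (form : {symmetric g}).
Hypothesis form_lor : lorentzian form.

(** The witness is the unique negative vector of an orthogonal basis: a vector orthogonal to it has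
    no coordinate along it, so its square is a sum of nonnegative terms. *)
Lemma lorentzian_timelike :
  exists e0 : g, forall y, form y e0 = 0 -> y != 0 -> 0 < form y y.
Proof.
have [e [e_basis e_orth e_neg e_pos]] := form_lor.
exists (tnth e ord0) => y y0 yN0.
have eE i : e`_i = nth 0 e i by [].
have yE : y = \sum_i coord e i y *: tnth e i.
  rewrite {1}(coord_basis e_basis (memvf y)); apply: eq_bigr => i _.
  by rewrite (tnth_nth 0).
have ye i : form y (tnth e i) = coord e i y * form (tnth e i) (tnth e i).
  rewrite {1}yE linear_sumlz (bigD1 i) //= linearZl_LR big1 /= ?addr0 // => j ji.
  by rewrite linearZl_LR /= e_orth ?mulr0.
have c0 : coord e ord0 y = 0.
  move: y0; rewrite ye => /eqP; rewrite mulf_eq0 => /orP[/eqP //|].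
  by rewrite lt_eqF ?e_neg.
have yy : form y y = \sum_i coord e i y ^+ 2 * form (tnth e i) (tnth e i).
  rewrite {2}yE linear_sumr; apply: eq_bigr => i _.
  by rewrite linearZr_LR /= ye mulrA expr2.
have ge0 i : 0 <= coord e i y ^+ 2 * form (tnth e i) (tnth e i).
  have [->|i0] := eqVneq i ord0; first by rewrite c0 expr0n mul0r.
  by rewrite mulr_ge0 ?sqr_ge0 // ltW // e_pos // lt0n.
rewrite lt_neqAle yy sumr_ge0 // andbT eq_sym; apply: contra_neq yN0 => /eqP.
rewrite psumr_eq0 // => /allP h; rewrite yE big1 // => i _.
suff -> : coord e i y = 0 by rewrite scale0r.
have [->//|i0] := eqVneq i ord0.
have := h i (mem_index_enum i); rewrite /= mulf_eq0 sqrf_eq0 => /orP[/eqP//|].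
by rewrite gt_eqF // e_pos // lt0n.
Qed.

(** With [e0] timelike, the combination [w] of [a] and [x] that is orthogonal to [e0] has square
    [form a e0 ^+ 2 * form x x <= 0], so it vanishes. Since [form a e0] is non-zero, [x] is a
    multiple of [a]. *)
Lemma lorentzian_null_orth (a x : g) : a != 0 -> form a a = 0 ->
  form x a = 0 -> form x x <= 0 -> x \in <[a]>%VS.
Proof.
move=> aN0 aa xa xx; have [e0 he0] := lorentzian_timelike.
have ae0 : form a e0 != 0.
  by apply/eqP => /he0 /(_ aN0); rewrite aa ltxx.
have w0 : form x e0 *: a - form a e0 *: x = 0.
  set w := _ - _; apply/eqP; apply: contraT => wN0.
  have we0 : form w e0 = 0 by rewrite /w linearBl !linearZl_LR /=; ring.
  have ww : form w w = form a e0 ^+ 2 * form x x.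
    by rewrite /w !linE /= aa [form a x]form_sym xa; ring.
  have := he0 w we0 wN0; rewrite ww ltNge mulr_ge0_le0 //; exact: sqr_ge0.
apply/vlineP; exists (form x e0 / form a e0).
rewrite mulrC -scalerA; move/eqP: w0; rewrite subr_eq0 => /eqP ->.
by rewrite scalerA mulVf // scale1r.
Qed.

Lemma lorentzian_orth_ge0 (a x : g) : a != 0 -> form a a = 0 ->
  form x a = 0 -> 0 <= form x x.
Proof.
move=> aN0 aa xa; rewrite leNgt; apply/negP => xx.
have /vlineP[k xE] := lorentzian_null_orth aN0 aa xa (ltW xx).
by move: xx; rewrite xE linearZl_LR linearZr_LR /= aa !mulr0 ltxx.
Qed.

End Lorentzian.

(** * The Levi-Civita product modulo a central null line *)

Section FlatKernel.
Variables (R : realType) (g : vectType R) (br : {bilinear g -> g -> g}).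
Variables (form : {symmetric g}) (a : g).
Hypotheses (br_lie : is_lie_algebra br) (br_nil : is_nilpotent_lie br).
Hypotheses (form_nd : nondegenerate form) (form_lor : lorentzian form).
Hypotheses (form_flat : flat br form) (aN0 : a != 0) (aa : form a a = 0).
Hypotheses (a_ker : lc_kernel br form a) (a_center : lie_center br a).

Local Notation m := (levi_civita br form).
Local Notation "x ~ y" := (x - y \in <[a]>%VS) (at level 70).
Local Notation h x := (form x a = 0).

Let hm : is_levi_civita br form m := levi_civitaP form_nd br_lie.

Lemma lcDl x y z : m (x + y) z = m x z + m y z.
Proof. by have := lc_linear_l hm z 1 x y; rewrite !scale1r. Qed.
Lemma lcDr x y z : m z (x + y) = m z x + m z y.
Proof. by have := lc_linear_r hm z 1 x y; rewrite !scale1r. Qed.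
Lemma lc0l z : m 0 z = 0.
Proof. by have := lc_linear_l hm z (-1) 0 0; rewrite scaler0 addr0 scaleN1r addNr. Qed.
Lemma lc0r z : m z 0 = 0.
Proof. by have := lc_linear_r hm z (-1) 0 0; rewrite scaler0 addr0 scaleN1r addNr. Qed.
Lemma lcZl k x z : m (k *: x) z = k *: m x z.
Proof. by have := lc_linear_l hm z k x 0; rewrite lc0l !addr0. Qed.
Lemma lcZr k x z : m z (k *: x) = k *: m z x.
Proof. by have := lc_linear_r hm z k x 0; rewrite lc0r !addr0. Qed.

Lemma lc_skew x y z : form (m x y) z = - form y (m x z).
Proof. by apply/eqP; rewrite -addr_eq0; apply/eqP; exact: lc_metric hm x y z. Qed.

Lemma lc_al y : m a y = 0. Proof. exact: a_ker. Qed.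
Lemma lc_ar y : m y a = 0.
Proof.
by have := lc_torsion_free hm a y; rewrite a_center lc_al sub0r => /eqP;
  rewrite eq_sym oppr_eq0 => /eqP.
Qed.
Lemma br_ar y : br y a = 0.
Proof. by rewrite (lc_torsion_free hm) lc_ar lc_al subrr. Qed.

Lemma lc_orth x y : h (m x y).
Proof. by rewrite lc_skew lc_ar linear0r oppr0. Qed.
Lemma br_orth x y : h (br x y).
Proof. by rewrite (lc_torsion_free hm) linearBl /= !lc_orth subrr. Qed.

(** As the product is torsion-free, left-symmetry says that left multiplication is a representation,
    that is, the curvature vanishes. *)
Lemma lc_flat x y z : m (br x y) z = m x (m y z) - m y (m x z).
Proof.
have := form_flat x y z; rewrite (lc_torsion_free hm) => /eqP.
rewrite subr_eq => /eqP e; have mB p q : m (p - q) z = m p z - m q z.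
  by rewrite lcDl -scaleN1r lcZl scaleN1r.
by rewrite mB e; module_ring.
Qed.

(** Both multiplications by [a] vanish, so the product depends on its arguments only modulo the
    line; likewise in [line_r]. *)
Lemma line_l x z y : x ~ z -> m x y = m z y.
Proof.
case/vlineP => k e; have -> : x = k *: a + z by rewrite -e subrK.
by rewrite lcDl lcZl lc_al scaler0 add0r.
Qed.
Lemma line_r x z y : x ~ z -> m y x = m y z.
Proof.
case/vlineP => k e; have -> : x = k *: a + z by rewrite -e subrK.
by rewrite lcDr lcZr lc_ar scaler0 add0r.
Qed.
Lemma line_form x y : x \in <[a]>%VS -> h y -> form x y = 0.
Proof. by case/vlineP => k -> hy; rewrite linearZl_LR /= form_sym hy mulr0. Qed.

Lemma null_line x : h x -> form x x = 0 -> x \in <[a]>%VS.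
Proof. by move=> xa xx; apply: (lorentzian_null_orth form_lor) => //; rewrite xx. Qed.

(** Skewness rewrites the square of [m x y] as minus the pairing of [y] with [m x (m x y)], which is
    0; a null vector orthogonal to [a] is on the line. This is the Euclidean fact that a skew map
    kills [y] as soon as its square does. *)
Lemma lc_sqr_line x y : h y -> m x (m x y) \in <[a]>%VS -> m x y \in <[a]>%VS.
Proof.
move=> hy e; apply: null_line; first exact: lc_orth.
by rewrite lc_skew form_sym (line_form e hy) oppr0.
Qed.

Lemma br_line x y : h x -> h y -> br x y \in <[a]>%VS.
Proof.
apply: (nilpotent_bracket_ind br_nil (H := fun x => h x) (P := fun z => z \in <[a]>%VS)).
- exact: mem0v.
- by move=> *; exact: br_orth.
move=> {}x {}y hx hy; set z := br x y => zc.
have hz : h z by exact: br_orth.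
have zw w : h w -> m z w ~ m w z.
  move=> hw; rewrite -(lc_torsion_free hm) -memvN.
  have -> : - br z w = br w z.
    apply/eqP; rewrite eq_sym -addr_eq0; apply/eqP.
    by have := lie_alternating br_lie (w + z); rewrite linearDl !linearDr /=
      !(lie_alternating br_lie) add0r addr0.
  exact: zc.
(* Koszul's formula, tested on [m z z] itself, only involves [br z z] and brackets with [z], which
   lie on the line by the induction hypothesis. *)
have zz : m z z \in <[a]>%VS.
  apply: null_line; first exact: lc_orth.
  set w := m z z; have hw : h w by exact: lc_orth.
  rewrite (levi_civita_koszul hm) (lie_alternating br_lie) linear0l.
  by rewrite (line_form (zc w hw) hz) !addr0 mulr0.
(* Flatness for [w], [z], [z] gives [m z (m w z) = 0], because [br w z] and [m z z] lie on the line.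
   As [m z w] and [m w z] agree modulo the line, also [m z (m z w) = 0]. *)
have z_line w : h w -> m z w \in <[a]>%VS.
  move=> hw; apply: lc_sqr_line => //.
  rewrite (line_r _ (zw w hw)).
  have := lc_flat w z z.
  have -> : m (br w z) z = 0.
    by rewrite (@line_l _ 0) ?lc0l // subr0; exact: zc.
  move/eqP; rewrite eq_sym subr_eq0 => /eqP <-.
  rewrite (@line_r _ 0) ?subr0 // lc0r; exact: mem0v.
(* One factor of [form z z] is expanded as [m x y - m y x]; skewness then leaves [x] and [y] paired
   with vectors [m w z], which lie on the line. *)
apply: null_line => //; rewrite {1}/z (lc_torsion_free hm) linearBl /=.
rewrite !lc_skew.
have mline w : h w -> m w z \in <[a]>%VS.
  move=> hw; have := memvB (z_line w hw) (zw w hw).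
  by rewrite opprB addrC subrK.
have sw u v : h u -> h v -> form u (m v z) = 0.
  by move=> hu hv; rewrite form_sym; apply: line_form; [exact: mline|].
by rewrite sw // sw // subrr.
Qed.

(** Koszul's formula computes the square of [m x y] from brackets of vectors orthogonal to [a], all
    on the line by [br_line]. *)
Lemma lc_line x y : h x -> h y -> m x y \in <[a]>%VS.
Proof.
move=> hx hy; have hmxy := lc_orth x y; apply: null_line => //.
rewrite (levi_civita_koszul hm) !(line_form (br_line _ _)) //.
by rewrite !addr0 mulr0.
Qed.

(** A nilpotent skew map of a Euclidean space is zero: [lc_sqr_line] lowers the exponent by one at a
    time. *)
Lemma iter_lc_line d k y : h y ->
  iter k.+1 (m d) y \in <[a]>%VS -> m d y \in <[a]>%VS.
Proof.
move=> hy; elim: k => [//|k IH] hk; apply: IH.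
have hj j : h (iter j (m d) y) by case: j => [//|j]; exact: lc_orth.
by rewrite iterS; apply: lc_sqr_line.
Qed.

Section Derivation.
Variable d : g.

(** Flatness for [d], [x], [d], whose remaining term [m x (m d d)] lies on the line by [lc_line]. In
    the notation of the overview this is u D = S u, and [lc_iter_br] iterates it. *)
Lemma lc_br_line x : h x -> m (br d x) d ~ m d (m x d).
Proof.
move=> hx; rewrite lc_flat addrAC subrr add0r memvN.
by apply: lc_line => //; exact: lc_orth.
Qed.

Lemma iter_lc_cong k x y : x ~ y -> iter k (m d) x ~ iter k (m d) y.
Proof.
by case: k => [//|k] xy; rewrite !iterSr (line_r _ xy) subrr mem0v.
Qed.

Lemma cong_trans y x z : x ~ y -> y ~ z -> x ~ z.
Proof. by move=> xy yz; have := memvD xy yz; rewrite addrA subrK. Qed.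

Lemma lc_iter_br k x : h x -> m (iter k (br d) x) d ~ iter k (m d) (m x d).
Proof.
elim: k x => [|k IH] x hx; first by rewrite subrr mem0v.
rewrite !iterSr; apply: (cong_trans (IH _ _)); first exact: br_orth.
by apply: iter_lc_cong; exact: lc_br_line.
Qed.

(* S = d * _, u = - (_ * d), D = [d, _] = S + u, all modulo [a]. *)
Lemma lc_lc_line x : h x -> m d (m x d) \in <[a]>%VS.
Proof.
move=> hx; have [k hk] := ad_nilpotent br_nil.
apply: (@iter_lc_line _ k); first exact: lc_orth.
have := lc_iter_br k.+1 hx.
by rewrite iterSr hk lc0l sub0r memvN.
Qed.

(* From S u = 0 one gets S D = S ^ 2, so S D ^ k = S ^ (k + 1). *)
Lemma lc_left_line x : h x -> m d x \in <[a]>%VS.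
Proof.
move=> hx; have [k hk] := ad_nilpotent br_nil.
have cong j y : h y -> m d (iter j (br d) y) ~ iter j.+1 (m d) y.
  elim: j y => [|j IH] y hy; first by rewrite subrr mem0v.
  rewrite iterSr [iter j.+2 _ _]iterSr; apply: (cong_trans (IH _ _)).
    exact: br_orth.
  rewrite iterSr [iter j.+1 _ (m d y)]iterSr; apply: iter_lc_cong.
  rewrite (lc_torsion_free hm) -scaleN1r lcDr lcZr scaleN1r addrAC subrr add0r.
  by rewrite memvN; exact: lc_lc_line.
apply: (@iter_lc_line _ k) => //.
by have := cong k x hx; rewrite hk lc0r sub0r memvN.
Qed.

Lemma br_lc_line x : h x -> br d x + m x d \in <[a]>%VS.
Proof.
by move=> hx; rewrite (lc_torsion_free hm) subrK; exact: lc_left_line.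
Qed.

(** Modulo the line u D = S u = 0 and D = u, hence u squared vanishes. *)
Lemma lc_right_sqr_line x : h x -> m (m x d) d \in <[a]>%VS.
Proof.
move=> hx.
have e : br d x ~ - m x d by rewrite opprK; exact: br_lc_line.
have := memvD (lc_br_line hx) (lc_lc_line hx).
by rewrite subrK (line_l _ e) -scaleN1r lcZl scaleN1r memvN.
Qed.

End Derivation.
End FlatKernel.

(** * The Hertling-Manin tensor of a double extension *)

Section HertlingManin.
Variables (R : realType) (V : vectType R).

Definition hm_tensor (br pr : V -> V -> V) (x y z w : V) : V :=
  br (pr x y) (pr z w) - pr (br (pr x y) z) w - pr (br (pr x y) w) z
  - pr x (br y (pr z w)) + pr (pr x (br y z)) w + pr (pr x (br y w)) z
  - pr y (br x (pr z w)) + pr (pr y (br x z)) w + pr (pr y (br x w)) z.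

Variables br pr : {bilinear V -> V -> V}.
Hypothesis pr_comm : forall x y, pr x y = pr y x.
Local Notation hm := (hm_tensor br pr).

(** Linearity is proved in the first and third arguments; [hm_sym12] and [hm_sym34] carry it to the
    other two. *)
Lemma hm_linear y z w : linear (fun x => hm x y z w).
Proof.
move=> k x x'; rewrite /hm_tensor !(linearPl, linearPr) /=; module_ring.
Qed.

Lemma hm_linear3 x y w : linear (fun z => hm x y z w).
Proof.
move=> k z z'; rewrite /hm_tensor !(linearPl, linearPr) /=; module_ring.
Qed.

Lemma hm_sym12 x y z w : hm x y z w = hm y x z w.
Proof. by rewrite /hm_tensor (pr_comm x y); module_ring. Qed.

Lemma hm_sym34 x y z w : hm x y z w = hm x y w z.
Proof. by rewrite /hm_tensor (pr_comm z w); module_ring. Qed.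

End HertlingManin.

(** * Bilinear structures on the double extension *)

Section DextBilinear.
Variables (R : realType) (B : vectType R).
Variables (brB prB : {bilinear B -> B -> B}) (form : {symmetric B}).
Variable p : dext_param B.

Lemma dext_eq (s s' t t' : R) (x x' : B) :
  s = s' -> x = x' -> t = t' -> ((s, x, t) : dext B) = (s', x', t').
Proof. by move=> -> -> ->. Qed.

Lemma dextD (s s' t t' : R) (x x' : B) :
  ((s, x, t) : dext B) + (s', x', t') = (s + s', x + x', t + t').
Proof. by []. Qed.

Lemma dextN (s t : R) (x : B) : - ((s, x, t) : dext B) = (- s, - x, - t).
Proof. by []. Qed.

Lemma scale_regular (k t : R) : k *: (t : R^o) = k * t.
Proof. by []. Qed.

Lemma dextZ k (s t : R) (x : B) :
  k *: ((s, x, t) : dext B) = (k * s, k *: x, k * t).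
Proof. by []. Qed.

Lemma dext0 : (0 : dext B) = (0, 0, 0). Proof. by []. Qed.

Fact dext_br_bilinear : bilinear_for *:%R *:%R (dext_br brB form p).
Proof.
split=> [[[s' x'] t']|[[s' x'] t']] k [[s x] t] [[s2 x2] t2];
  rewrite /= !(dextD, dextZ); apply: dext_eq; rewrite ?scale_regular;
  rewrite ?(linE, linearP) /= ?(linE, linearP) /=; try ring; module_ring.
Qed.
HB.instance Definition _ := bilinear_isBilinear.Build R (dext B) (dext B)
  (dext B) *:%R *:%R (dext_br brB form p) dext_br_bilinear.

Fact dext_pr_bilinear : bilinear_for *:%R *:%R (dext_pr prB form p).
Proof.
split=> [[[s' x'] t']|[[s' x'] t']] k [[s x] t] [[s2 x2] t2];
  rewrite /= !(dextD, dextZ); apply: dext_eq; rewrite ?scale_regular;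
  rewrite ?(linE, linearP) /= ?(linE, linearP) /=; try ring; module_ring.
Qed.
HB.instance Definition _ := bilinear_isBilinear.Build R (dext B) (dext B)
  (dext B) *:%R *:%R (dext_pr prB form p) dext_pr_bilinear.

Fact dext_form_bilinear :
  bilinear_for *%R (idfun \; *%R) (dext_form form : dext B -> dext B -> R).
Proof.
split=> [[[s' x'] t']|[[s' x'] t']] k [[s x] t] [[s2 x2] t2];
  rewrite /= ?linE /= ?scale_regular; ring.
Qed.
HB.instance Definition _ := bilinear_isBilinear.Build R (dext B) (dext B)
  R *%R (idfun \; *%R) (dext_form form) dext_form_bilinear.

Fact dext_form_sym (X Y : dext B) :
  dext_form form X Y = (-1) ^+ false * idfun (dext_form form Y X).
Proof.
case: X Y => [[s x] t] [[s' x'] t']; rewrite /= form_sym; ring.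
Qed.
HB.instance Definition _ := isHermitianSesquilinear.Build R (dext B) false idfun
  (dext_form form) dext_form_sym.

End DextBilinear.

(** * Entries of the Hertling-Manin tensor on generators *)

Section MultiplicationTable.
Variables (R : realType) (B V : vectType R).
Variables (prB : {bilinear B -> B -> B}) (form : {symmetric B}).
Variables (beta : R) (a0 b0 : B) (D v : {linear B -> B}).
Variables (br pr : V -> V -> V) (T : R -> B -> V) (d : V).

Definition dext_omega (x y : B) : R := form (D x) y - form x (D y).

(* [T c x] stands for c a + x in the double extension. *)
Record dext_table : Prop := DextTable {
  tabD : forall c x c' x', T c x + T c' x' = T (c + c') (x + x');
  tabZ : forall k c x, k *: T c x = T (k * c) (k *: x);
  tab0 : T 0 0 = 0;
  br_bb : forall c x c' y, br (T c x) (T c' y) = T (dext_omega x y) 0;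
  br_db : forall c x, br d (T c x) = T (- form b0 x) (D x);
  br_bd : forall c x, br (T c x) d = T (form b0 x) (- D x);
  br_dd : br d d = 0;
  pr_bb : forall c x c' y, pr (T c x) (T c' y) = T (form (v x) y) (prB x y);
  pr_db : forall c x, pr d (T c x) = T (form a0 x) (v x);
  pr_bd : forall c x, pr (T c x) d = T (form a0 x) (v x);
  pr_dd : pr d d = T beta a0 }.

Hypothesis tab : dext_table.

Local Notation hm := (hm_tensor br pr).
Local Notation "x ** y" := (prB x y) (at level 40).
Local Notation om := dext_omega.

Lemma tabN c x : - T c x = T (- c) (- x).
Proof. by rewrite -scaleN1r (tabZ tab) mulN1r scaleN1r. Qed.

Let br_dd' : br d d = T 0 0. Proof. by rewrite (br_dd tab) (tab0 tab). Qed.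
Let table := (br_bb tab, br_db tab, br_bd tab, br_dd', pr_bb tab,
  pr_db tab, pr_bd tab, pr_dd tab).

Ltac hm_case := rewrite /hm_tensor !table !tabN !(tabD tab);
  congr T; rewrite /dext_omega ?(linE, linearN D, linearN v, linear0 D, linear0 v);
  [ring | module_ring].

(** In these names [b] marks an argument [T c x] and [d] an argument [d]. The scalars [cx], [cy]
    drop out because no entry of the table depends on them. *)
Lemma hm_bbbb cx x cy y cz z cw w : hm (T cx x) (T cy y) (T cz z) (T cw w) = T (om (x ** y) (z ** w)) 0.
Proof. hm_case. Qed.

Lemma hm_bbdb cx x cy y cw w : hm (T cx x) (T cy y) d (T cw w) =
  T (om (x ** y) (v w) + form (v (D (x ** y))) w
       - form (v (x ** D y)) w - form (v (y ** D x)) w)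
    (D (x ** y) ** w - (x ** D y) ** w - (y ** D x) ** w).
Proof. hm_case. Qed.

Lemma hm_bbdd cx x cy y : hm (T cx x) (T cy y) d d =
  T (om (x ** y) a0 + 2 * form a0 (D (x ** y)) - 2 * form a0 (x ** D y)
       - 2 * form a0 (y ** D x))
    (2 *: v (D (x ** y)) - 2 *: v (x ** D y) - 2 *: v (y ** D x)).
Proof. hm_case. Qed.

Lemma hm_dbbb cy y cz z cw w : hm d (T cy y) (T cz z) (T cw w) =
  T (om (v y) (z ** w) - form (v y) (D (z ** w))
       + form (v (y ** D z)) w + form (v (y ** D w)) z)
    ((y ** D z) ** w + (y ** D w) ** z - y ** D (z ** w)).
Proof. hm_case. Qed.

Lemma hm_dbdb cx x cw w : hm d (T cx x) d (T cw w) =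
  T (om (v x) (v w) + form (v (D (v x))) w - form (v (v (D x))) w
       - form (v x) (D (v w)) + form a0 (x ** D w))
    (D (v x) ** w - v (D x) ** w - x ** D (v w) + v (x ** D w)).
Proof. hm_case. Qed.

Lemma hm_dbdd cx x : hm d (T cx x) d d =
  T (om (v x) a0 + 2 * form a0 (D (v x)) - form (v x) (D a0)
       - 2 * form a0 (v (D x)))
    (2 *: v (D (v x)) - x ** D a0 - 2 *: v (v (D x))).
Proof. hm_case. Qed.

Lemma hm_ddbb cz z cw w : hm d d (T cz z) (T cw w) =
  T (om a0 (z ** w) - 2 * form a0 (D (z ** w))
       + 2 * form (v (v (D z))) w + 2 * form (v (v (D w))) z)
    (2 *: (v (D z) ** w) + 2 *: (v (D w) ** z) - 2 *: v (D (z ** w))).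
Proof. hm_case. Qed.

Lemma hm_dddb cw w : hm d d d (T cw w) =
  T (om a0 (v w) + form (v (D a0)) w - 2 * form a0 (D (v w))
       + 2 * form a0 (v (D w)))
    (D a0 ** w - 2 *: v (D (v w)) + 2 *: v (v (D w))).
Proof. hm_case. Qed.

Lemma hm_dddd : hm d d d d = 0.
Proof.
rewrite /hm_tensor !table !tabN !(tabD tab) -(tab0 tab); congr T.
  by rewrite /dext_omega [form (D a0) a0]form_sym; ring.
by rewrite ?(linE, linearN D, linearN v, linear0 D, linear0 v); module_ring.
Qed.

End MultiplicationTable.

Section TableProducts.
Variables (R : realType) (B V : vectType R).
Variables (prB : {bilinear B -> B -> B}) (form : {symmetric B}).
Variables (beta : R) (a0 b0 : B) (D v : {linear B -> B}).
Variables (br pr : {bilinear V -> V -> V}) (T : R -> B -> V) (d : V).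
Hypothesis tab : dext_table prB form beta a0 b0 D v br pr T d.

Lemma table_br s x t s' x' t' : br (T s x + t *: d) (T s' x' + t' *: d) =
  T (t' * form b0 x - t * form b0 x' + dext_omega form D x x') (t *: D x' - t' *: D x).
Proof.
rewrite linearDl !linearDr !linearZl_LR !linearZr_LR /=.
rewrite (br_bb tab) (br_bd tab) (br_db tab) (br_dd tab) !scaler0 addr0.
by rewrite !(tabZ tab) !(tabD tab); congr T; [ring | module_ring].
Qed.

Lemma table_pr s x t s' x' t' : pr (T s x + t *: d) (T s' x' + t' *: d) =
  T (beta * (t * t') + t * form a0 x' + t' * form a0 x + form (v x) x')
    ((t * t') *: a0 + t *: v x' + t' *: v x + prB x x').
Proof.
rewrite linearDl !linearDr !linearZl_LR !linearZr_LR /=.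
rewrite (pr_bb tab) (pr_bd tab) (pr_db tab) (pr_dd tab).
by rewrite !(tabZ tab) !(tabD tab); congr T; [ring | module_ring].
Qed.

End TableProducts.

(** The table determines both operations, so matching generators suffices. It will compare the
    original algebra with the double extension. *)
Lemma table_morphism (R : realType) (B V V' : vectType R)
    (prB : {bilinear B -> B -> B}) (form : {symmetric B}) (beta : R) (a0 b0 : B)
    (D v : {linear B -> B}) (br pr : {bilinear V -> V -> V}) (T : R -> B -> V)
    (d : V) (br' pr' : {bilinear V' -> V' -> V'}) (T' : R -> B -> V') (d' : V')
    (phi : {linear V -> V'}) :
  dext_table prB form beta a0 b0 D v br pr T d ->
  dext_table prB form beta a0 b0 D v br' pr' T' d' ->
  (forall c x, phi (T c x) = T' c x) -> phi d = d' ->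
  (forall X, exists s x t, X = T s x + t *: d) ->
  forall X Y, phi (br X Y) = br' (phi X) (phi Y) /\
              phi (pr X Y) = pr' (phi X) (phi Y).
Proof.
move=> tab tab' phiT phid span X Y.
have [s [x [t ->]]] := span X; have [s' [x' [t' ->]]] := span Y.
have phiE c y k : phi (T c y + k *: d) = T' c y + k *: d'.
  by rewrite linearD linearZ /= phiT phid.
rewrite !phiE.
by rewrite (table_br tab) (table_br tab') (table_pr tab) (table_pr tab') !phiT.
Qed.

(** * The double extension with vanishing [mu] and [lambda], and [u] equal to [D] *)

Section SpecialDext.
Variables (R : realType) (B : vectType R).
Variables (brB prB : {bilinear B -> B -> B}) (form : {symmetric B}).
Variables (beta : R) (a0 b0 : B) (D v : {linear B -> B}).
Hypotheses (brB0 : is_abelian brB) (form_nd : nondegenerate form).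

Local Notation p := (DextParam 0 0 beta a0 b0 D D v).
Local Notation dbr := (dext_br brB form p).
Local Notation dpr := (dext_pr prB form p).
Local Notation dd := ((0, 0, 1) : dext B).
Local Notation "x ** y" := (prB x y) (at level 40).

Local Notation om := (dext_omega form D).

Lemma form_adjointr (f : {linear B -> B}) x y :
  form x (adjoint form f y) = form (f x) y.
Proof. by rewrite -adjointP. Qed.

Lemma form_adjointl (f : {linear B -> B}) x y :
  form (adjoint form f x) y = form x (f y).
Proof. by rewrite form_sym form_adjointr // form_sym. Qed.

Ltac dext_case := rewrite /dext_omega;
  apply: dext_eq; rewrite ?brB0 /= ?linearBl /= ?form_adjointl ?(linE, linear0) /=
    ?(mul0r, mulr0, mul1r, scale0r, scale1r); rewrite ?(add0r, addr0, subr0, sub0r, oppr0);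
  rewrite ?linear0r ?linear0l ?linear0 ?oppr0 ?addr0 //; try ring.

Lemma dbr_bb s x s' y : dbr (s, x, 0) (s', y, 0) = (om x y, 0, 0).
Proof. dext_case. Qed.
Lemma dbr_db s x : dbr dd (s, x, 0) = (- form b0 x, D x, 0).
Proof. dext_case. Qed.
Lemma dbr_bd s x : dbr (s, x, 0) dd = (form b0 x, - D x, 0).
Proof. dext_case. Qed.
Lemma dbr_dd : dbr dd dd = (0, 0, 0).
Proof. dext_case. Qed.
Lemma dpr_bb s x s' y : dpr (s, x, 0) (s', y, 0) = (form (v x) y, x ** y, 0).
Proof. dext_case. Qed.
Lemma dpr_db s x : dpr dd (s, x, 0) = (form a0 x, v x, 0).
Proof. dext_case. Qed.
Lemma dpr_bd s x : dpr (s, x, 0) dd = (form a0 x, v x, 0).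
Proof. dext_case. Qed.
Lemma dpr_dd : dpr dd dd = (beta, a0, 0).
Proof. dext_case. Qed.


Lemma dext_tableP : dext_table prB form beta a0 b0 D v dbr dpr
  (fun c x => ((c, x, 0) : dext B)) dd.
Proof.
split; [ | | by [] | exact: dbr_bb | exact: dbr_db | exact: dbr_bd
  | exact: dbr_dd | exact: dpr_bb | exact: dpr_db | exact: dpr_bd | exact: dpr_dd].
- by move=> c x c' x'; rewrite dextD addr0.
- by move=> k c x; rewrite dextZ mulr0.
Qed.

End SpecialDext.

(** * Admissibility against the Hertling-Manin relation *)

Section Admissible.
Variables (R : realType) (B : vectType R).
Variables (brB prB : {bilinear B -> B -> B}) (form : {symmetric B}).
Variables (beta : R) (a0 b0 : B) (D v : {linear B -> B}).
Variables (V : vectType R) (br pr : {bilinear V -> V -> V}) (T : R -> B -> V) (d : V).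
Hypotheses (brB0 : is_abelian brB) (form_nd : nondegenerate form).

Local Notation p := (DextParam 0 0 beta a0 b0 D D v).
Local Notation hm := (hm_tensor br pr).
Local Notation "x ** y" := (prB x y) (at level 40).

Lemma lie_abelian : is_lie_algebra brB.
Proof. by split=> *; rewrite !brB0 ?addr0. Qed.

Lemma levi_civita_abelian x y : levi_civita brB form x y = 0.
Proof.
apply: (form_inj form_nd) => z.
rewrite (levi_civita_koszul (levi_civitaP form_nd lie_abelian)) !brB0.
by rewrite !linear0l !addr0 mulr0.
Qed.

Lemma adjoint_abelian x y : adjoint form (brB x) y = 0.
Proof.
by apply: (adjoint_unique form_nd (h := fun=> 0)) => z w; rewrite /= brB0 linear0l linear0r.
Qed.

Hypothesis tab : dext_table prB form beta a0 b0 D v br pr T d.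
Hypothesis prB_ca : is_comm_assoc prB.
Hypothesis prB_inv : forall x y z, form (x ** y) z = form x (y ** z).
Hypothesis v_sym : forall x y, form (v x) y = form x (v y).
Hypothesis v_prod : forall x y, v (x ** y) = v x ** y.
Hypothesis v_sqr : forall x, v (v x) = x ** a0.

Let fsym x y : form x y = form y x := form_sym form x y.
Let comm x y : x ** y = y ** x := prod_comm prB_ca x y.
Let adjl := form_adjointl form_nd.

Let prL x z y : form (x ** z) y = form z (x ** y).
Proof. by rewrite comm prB_inv. Qed.
Let v_prodr x y : v (x ** y) = x ** v y.
Proof. by rewrite comm v_prod comm. Qed.

Ltac scalar_norm := rewrite ?(adjoint_abelian, brB0) ?expr0n
  ?(mul0r, scale0r, linear0 v, linearN v, linearB v, linearD v) /=
  ?linE ?adjl ?v_sqr /=; do 3!rewrite ?v_sym ?prL ?adjl ?linE.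

(** With [B] abelian and [u] equal to [D], the first eight conditions follow from [D (D x) = 0] and
    the properties of [v]. The other nine are the components of the entries [dbdd], [bbdd], [dbdb],
    [bbdb] and [bbbb]. *)
Lemma special_admissible : (forall c x, T c x = 0 -> c = 0 /\ x = 0) ->
  (forall x, D (D x) = 0) ->
  (forall X Y Z W, hm X Y Z W = 0) -> dext_admissible brB prB form p.
Proof.
move=> T_inj DD HM.
split=> /=.
- by move=> x y; rewrite brB0 linear0 !levi_civita_abelian subrr.
- by move=> x y; rewrite !brB0 linear0 addr0.
- exact: v_prod.
- move=> x; have -> : (fun y => D y - D y) = (\0 : B -> B).
    by apply/funext => y; rewrite subrr.
  rewrite subrr oppr0; apply: (adjoint_unique form_nd (h := fun=> 0)) => z w.
  by rewrite linear0l linear0r.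
- by move=> x; apply: (form_inj form_nd) => y; rewrite adjl v_sym.
- by move=> x; rewrite /commutator levi_civita_abelian !DD scale0r !subr0.
- by move=> x y; rewrite !levi_civita_abelian linear0 !subr0 addr0.
- by move=> x; rewrite scale0r add0r.
- apply: (form_inj form_nd) => y.
  have [+ _] := T_inj _ _ (etrans (esym (hm_dbdd tab 0 y)) (HM _ _ _ _)).
  rewrite /dext_omega [form (D (v y)) _]fsym [form (v y) _]fsym => E.
  scalar_norm.
  lra.
- move=> x; have [_ +] := T_inj _ _ (etrans (esym (hm_dbdd tab 0 x)) (HM _ _ _ _)).
  rewrite /commutator /= !brB0 linear0 subrr scale0r !add0r => E.
  rewrite -oppr0 -E. by module_ring.
- move=> x; apply: (form_inj form_nd) => y.
  have [+ _] := T_inj _ _ (etrans (esym (hm_bbdd tab 0 x 0 y)) (HM _ _ _ _)).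
  rewrite /dext_omega [form (D _) _]fsym [form (x ** y) _]fsym [y ** _]comm => E.
  scalar_norm; lra.
- move=> x y; have [_ +] := T_inj _ _ (etrans (esym (hm_bbdd tab 0 x 0 y)) (HM _ _ _ _)).
  rewrite !brB0 !linear0r !subr0 scale0r subr0 add0r => <-.
  by rewrite !linearB /=; module_ring.
- move=> x; apply: (form_inj form_nd) => y.
  have [+ _] := T_inj _ _ (etrans (esym (hm_dbdb tab 0 x 0 y)) (HM _ _ _ _)).
  rewrite /dext_omega => E; scalar_norm; move: E; scalar_norm.
  lra.
- move=> x y; have [_ E] := T_inj _ _ (etrans (esym (hm_dbdb tab 0 x 0 y)) (HM _ _ _ _)).
  rewrite !brB0 ?(linear0 v, subr0, addr0, add0r) -[RHS]E linearB /= -v_prod.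
  by rewrite (comm (D x)) (comm (D (v y))); module_ring.
- move=> x y; apply: (form_inj form_nd) => w.
  have [+ _] := T_inj _ _ (etrans (esym (hm_bbdb tab 0 x 0 y 0 w)) (HM _ _ _ _)).
  rewrite /dext_omega => E; scalar_norm; move: E; scalar_norm.
  lra.
- move=> x y z.
  have [_ E] := T_inj _ _ (etrans (esym (hm_bbdb tab 0 x 0 y 0 z)) (HM _ _ _ _)).
  by rewrite !brB0 !linear0r ?(linear0 v, subr0, addr0, add0r) -[RHS]E.
- move=> x y z; apply: (form_inj form_nd) => w.
  have [+ _] := T_inj _ _ (etrans (esym (hm_bbbb tab 0 x 0 y 0 z 0 w)) (HM _ _ _ _)).
  rewrite /dext_omega => E; rewrite ?(adjoint_abelian, brB0) ?(linear0 v) ?linE.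
  by rewrite /= ?subr0 ?(linear0 v) ?linE /= !prB_inv adjl; lra.
Qed.

Hypothesis T_span : forall X, exists s x t, X = T s x + t *: d.

(** The five entries used in [special_admissible] vanish by the nine conditions. The entries [dbbb],
    [ddbb] and [dddb] reuse those of [bbdb], [bbdd] and [dbdd] after commuting factors, and [dddd]
    vanishes identically. *)
Lemma special_hertling_manin : (forall x y, pr x y = pr y x) ->
  dext_admissible brB prB form p -> forall X Y Z W, hm X Y Z W = 0.
Proof.
move=> pr_comm [_ _ _ _ _ _ _ _ /= cond1 cond2 cond3 cond4 cond5 cond6 cond7 cond8 cond9].
have T0 c x : c = 0 -> x = 0 -> T c x = 0 by move=> -> ->; exact: tab0 tab.
have bbbb cx x cy y cz z cw w : hm (T cx x) (T cy y) (T cz z) (T cw w) = 0.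
  rewrite (hm_bbbb tab); apply: T0 => //; rewrite /dext_omega.
  have := congr1 (form ^~ w) (cond9 x y z).
  rewrite ?(adjoint_abelian, brB0) ?(linear0 v) ?linE.
  by rewrite /= ?subr0 ?(linear0 v) ?linE /= !prB_inv adjl !prB_inv; lra.
have bbdb cx x cy y cw w : hm (T cx x) (T cy y) d (T cw w) = 0.
  rewrite (hm_bbdb tab); apply: T0; last first.
    rewrite -[RHS](cond8 x y w).
    by rewrite !brB0 !linear0r ?(linear0 v, subr0, addr0, add0r).
  rewrite /dext_omega; have := congr1 (form ^~ w) (cond7 x y); scalar_norm.
  lra.
have bbdd cx x cy y : hm (T cx x) (T cy y) d d = 0.
  rewrite (hm_bbdd tab); apply: T0; last first.
    rewrite -[RHS](cond4 x y).
    rewrite !brB0 !linear0r !subr0 scale0r subr0 add0r.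
    by rewrite !linearB /=; module_ring.
  rewrite /dext_omega [form (D _) _]fsym [form (x ** y) _]fsym [y ** _]comm.
  have := congr1 (form ^~ y) (cond3 x); scalar_norm; lra.
have dbbb cy y cz z cw w : hm d (T cy y) (T cz z) (T cw w) = 0.
  rewrite (hm_dbbb tab); apply: T0; last first.
    have := cond8 z w y; rewrite !brB0 !linear0r ?(linear0 v, subr0, addr0, add0r).
    have sw u t : (y ** u) ** t = (t ** u) ** y.
      by rewrite [LHS]comm [y ** u]comm (prod_assoc prB_ca).
    move=> E; rewrite -[RHS]oppr0 -[in RHS]E !sw [y ** D _]comm.
    by module_ring.
  rewrite /dext_omega; have := congr1 (form ^~ y) (cond7 z w); scalar_norm.
  have s1 X : form y (v X) = form X (v y) by rewrite -v_sym fsym.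
  rewrite !s1 -[form w _]prL [form (z ** w) _]fsym -(v_prodr y w) -(v_prodr y z).
  by rewrite ![y ** _]comm !v_prodr; lra.
have dbdb cx x cw w : hm d (T cx x) d (T cw w) = 0.
  rewrite (hm_dbdb tab); apply: T0; last first.
    rewrite -[RHS](cond6 x w) !brB0 ?(linear0 v, subr0, addr0, add0r) linearB /= -v_prod.
    by rewrite (comm (D x)) (comm (D (v w))); module_ring.
  rewrite /dext_omega; have := congr1 (form ^~ w) (cond5 x); scalar_norm; lra.
have dbdd cx x : hm d (T cx x) d d = 0.
  rewrite (hm_dbdd tab); apply: T0; last first.
    rewrite -oppr0 -(cond2 x) /commutator /= !brB0 linear0 subrr scale0r !add0r.
    by module_ring.
  rewrite /dext_omega [form (D (v x)) _]fsym [form (v x) _]fsym.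
  have := congr1 (form ^~ x) cond1; scalar_norm; lra.
have ddbb cz z cw w : hm d d (T cz z) (T cw w) = 0.
  rewrite (hm_ddbb tab); apply: T0; last first.
    have := cond4 z w; rewrite !brB0 !linear0r !subr0 scale0r subr0 add0r.
    rewrite !linearB /= [z ** D w]comm [w ** D z]comm !v_prod => E.
    by rewrite -[RHS]oppr0 -[in RHS]E; module_ring.
  rewrite /dext_omega [form (v (v _)) z]fsym.
  have := congr1 (form ^~ w) (cond3 z); scalar_norm.
  by rewrite [form z _]fsym prL [D w ** z]comm; lra.
have dddb cw w : hm d d d (T cw w) = 0.
  rewrite (hm_dddb tab); apply: T0; last first.
    rewrite -[RHS](cond2 w) /commutator /= !brB0 linear0 subrr scale0r !add0r.
    by rewrite comm; module_ring.
  rewrite /dext_omega; have := congr1 (form ^~ w) cond1; scalar_norm.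
  lra.
have gen_lin X Y Z W : hm d Y Z W = 0 -> (forall c x, hm (T c x) Y Z W = 0) ->
    hm X Y Z W = 0.
  have [s [x [t ->]]] := T_span X => hd hT.
  by rewrite addrC hm_linear hd hT scaler0 addr0.
have gen_lin3 X Y Z W : hm X Y d W = 0 -> (forall c x, hm X Y (T c x) W = 0) ->
    hm X Y Z W = 0.
  have [s [x [t ->]]] := T_span Z => hd hT.
  by rewrite addrC hm_linear3 hd hT scaler0 addr0.
have sym12 := hm_sym12 br pr_comm; have sym34 := hm_sym34 br pr_comm.
(* For a fixed first pair, expansion of the last two arguments leaves three kinds of second pair. *)
have full X Y : hm X Y d d = 0 -> (forall c x, hm X Y d (T c x) = 0) ->
    (forall c x c' x', hm X Y (T c x) (T c' x') = 0) -> forall Z W, hm X Y Z W = 0.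
  move=> h1 h2 h3 Z W; apply: (gen_lin3) => [|c x]; rewrite sym34; apply: (gen_lin3).
  - exact: h1.
  - by move=> c x; rewrite sym34.
  - exact: h2.
  - by move=> c' x'; exact: h3.
move=> X Y Z W; apply: (gen_lin) => [|c x]; rewrite sym12; apply: (gen_lin).
- by apply: full => //; exact: hm_dddd tab.
- by move=> c x; rewrite sym12; apply: full.
- by apply: full.
- by move=> c' x'; apply: full.
Qed.

End Admissible.

(** * From Lorentzian algebras to double extensions *)

Section Pullbacks.
Variables (R : realType) (U V : vectType R).

Definition zero_bilinear (x y : U) : U := 0.
Fact zero_bilinear_bilinear : bilinear_for *:%R *:%R zero_bilinear.
Proof. by split=> x k y z; rewrite /= /zero_bilinear scaler0 addr0. Qed.
HB.instance Definition _ := bilinear_isBilinear.Build R U U U *:%R *:%R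
  zero_bilinear zero_bilinear_bilinear.

Variables (iota : {linear U -> V}) (form : {symmetric V}).

Definition pull_form (x y : U) : R := form (iota x) (iota y).
Fact pull_form_bilinear : bilinear_for *%R (idfun \; *%R) pull_form.
Proof.
by split=> x k y z; rewrite /= /pull_form linearP ?linearPl ?linearPr.
Qed.
HB.instance Definition _ := bilinear_isBilinear.Build R U U R
  *%R (idfun \; *%R) pull_form pull_form_bilinear.
Fact pull_form_sym x y : pull_form x y = (-1) ^+ false * idfun (pull_form y x).
Proof. by rewrite /pull_form form_sym expr0 mul1r. Qed.
HB.instance Definition _ := isHermitianSesquilinear.Build R U false idfun
  pull_form pull_form_sym.

Variables (pi : {linear V -> U}) (f : {bilinear V -> V -> V}).

Definition pull_mul (x y : U) : U := pi (f (iota x) (iota y)).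
Fact pull_mul_bilinear : bilinear_for *:%R *:%R pull_mul.
Proof.
by split=> x k y z; rewrite /= /pull_mul linearP ?linearPl ?linearPr linearP.
Qed.
HB.instance Definition _ := bilinear_isBilinear.Build R U U U *:%R *:%R
  pull_mul pull_mul_bilinear.

End Pullbacks.

Lemma nondegenerateI (R : realType) (V : vectType R) (form : {symmetric V}) :
  (forall x, (forall y, form x y = 0) -> x = 0) -> nondegenerate form.
Proof.
move=> h; rewrite /nondegenerate -subv0; apply/subvP => x /mem_orthovP hx.
by rewrite memv0; apply/eqP/h => y; apply: hx; rewrite memvf.
Qed.

(** [B] is the orthogonal of the hyperbolic plane of [a] and [d]. Since [form a d = 1], the
    coefficient along [a] is the pairing with [d] and conversely, and [pi] subtracts both
    components. *)
Lemma hyperbolic_splitting (R : realType) (g : vectType R) (form : {symmetric g})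
    (a d : g) : form a a = 0 -> form d d = 0 -> form a d = 1 ->
  exists (B : vectType R) (iota : {linear B -> g}) (pi : {linear g -> B}),
    [/\ cancel iota pi, forall x, form (iota x) a = 0, forall x, form (iota x) d = 0,
        pi a = 0 /\ pi d = 0 &
        forall X, X = form X d *: a + iota (pi X) + form X a *: d].
Proof.
move=> aa dd ad; have da : form d a = 1 by rewrite form_sym.
pose U := (orthov form <[a]> :&: orthov form <[d]>)%VS.
have UP x : x \in U -> form x a = 0 /\ form x d = 0.
  by rewrite memv_cap !mem_orthov1 => /andP[/eqP -> /eqP ->].
pose q X := X - form X d *: a - form X a *: d.
have qU X : q X \in U.
  rewrite memv_cap !mem_orthov1 /q !linearBl !linearZl_LR /= aa dd ad da.
  by rewrite !mulr0 !mulr1 !subr0 !subrr !eqxx.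
have q_lin : linear q.
  by move=> k X Y; rewrite /q !linearPl /=; module_ring.
pose pi X : subvs_of U := vsproj U (q X).
have pi_lin : linear pi by move=> k X Y; rewrite /pi q_lin linearP.
pose piL := HB.pack_for {linear g -> subvs_of U} pi
  (GRing.isLinear.Build R g (subvs_of U) *:%R pi pi_lin).
have qa : q a = 0 by rewrite /q aa ad scale1r scale0r subrr subr0.
have qd : q d = 0 by rewrite /q dd da scale1r scale0r subr0 subrr.
exists (subvs_of U), (vsval : {linear subvs_of U -> g}), piL; split.
- move=> x; have [xa xd] := UP _ (subvsP x).
  by rewrite /= /pi /q xa xd !scale0r !subr0 vsvalK.
- by move=> x; have [] := UP _ (subvsP x).
- by move=> x; have [] := UP _ (subvsP x).
- by rewrite /= /pi qa qd linear0.
- move=> X; rewrite /= /pi vsprojK // /q; module_ring.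
Qed.

(** * Choice of the dual null vector *)

Section ChooseDual.
Variables (R : realType) (g : vectType R) (br : {bilinear g -> g -> g}).
Variables (form : {symmetric g}) (a : g).
Hypotheses (br_lie : is_lie_algebra br) (br_nil : is_nilpotent_lie br).
Hypotheses (form_nd : nondegenerate form) (form_lor : lorentzian form).
Hypotheses (form_flat : flat br form) (aN0 : a != 0) (aa : form a a = 0).
Hypotheses (a_ker : lc_kernel br form a) (a_center : lie_center br a).
Local Notation m := (levi_civita br form).
Local Notation h x := (form x a = 0).

Lemma exists_dual_vector : exists d, [/\ form a d = 1, form d d = 0 &
  forall x, h x -> form (m d d) (br d x) = 0].
Proof.
have [d0 ad0] : exists d0, form a d0 = 1.
  case: (pselect (exists z, form a z != 0)) => [[z az]|nz].
    by exists ((form a z)^-1 *: z); rewrite linearZr_LR /= mulVf.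
  case/eqP: aN0; apply: (nondegenerateE form_nd) => y.
  by apply/eqP/negPn/negP => ay; apply: nz; exists y.
pose U := orthov form <[a]>%VS.
have UP x : x \in U <-> h x.
  by rewrite /U mem_orthov1; split => [/eqP//|->].
(* Modulo the line, replacing [d0] by [d0 + b] with [b] in [U] subtracts [br d0 b] from [m d0 d0],
   so [b] is taken with [br d0 b] the projection of [m d0 d0] onto [W]. *)
pose W := (linfun (br d0) @: U)%VS.
have WU : {subset vbasis W <= U}.
  move=> x /vbasis_mem /memv_imgP [z _ ->]; rewrite lfunE /=.
  by apply/UP; exact: br_orth.
have rad z w : z \in U -> w \in U -> form z z = 0 -> form z w = 0.
  move=> /UP hz /UP hw zz; apply: (@line_form _ _ form a) => //.
  exact: (null_line form_lor).
have yU : m d0 d0 \in U by apply/UP; exact: lc_orth.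
have [w] := orthogonal_projection rad WU yU.
rewrite (span_basis (vbasisP W)) => /memv_imgP [b /UP hb ->] hw.
rewrite lfunE /= in hw.
(* Adding [c *: a] makes the vector null and does not affect the products. *)
pose d1 := d0 + b; pose c := - (form d1 d1 / 2); pose d := d1 + c *: a.
have ad1 : form a d1 = 1 by rewrite linearDr /= ad0 [form a b]form_sym hb addr0.
have mdd : (m d d - (m d0 d0 - br d0 b)) \in <[a]>%VS.
  have da : d - d1 \in <[a]>%VS by rewrite /d addrAC subrr add0r memvZ ?memv_line.
  rewrite (line_l br_lie form_nd a_ker _ da) (line_r br_lie form_nd a_ker a_center _ da).
  rewrite /d1 lcDl // !lcDr //.
  have h1 : br d0 b + m b d0 \in <[a]>%VS by exact: br_lc_line.
  have h2 : m d0 b \in <[a]>%VS by exact: lc_left_line.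
  have h3 : m b b \in <[a]>%VS by exact: lc_left_line.
  have -> : m d0 d0 + m d0 b + (m b d0 + m b b) - (m d0 d0 - br d0 b) =
    (br d0 b + m b d0) + m d0 b + m b b by module_ring.
  by apply: rpredD => //; apply: rpredD.
exists d; split.
- by rewrite /d linearDr linearZr_LR /= aa mulr0 addr0.
- have dd u k : form a u = 1 -> form (u + k *: a) (u + k *: a) = form u u + 2 * k.
    move=> au; rewrite linearDl !linearDr !linearZl_LR !linearZr_LR /= aa au.
    by rewrite [form u a]form_sym au; ring.
  by rewrite /d dd // /c; lra.
move=> x hx.
have hbr : h (br d x) by exact: br_orth.
have := line_form mdd hbr; rewrite linearBl /= => /eqP; rewrite subr_eq0 => /eqP ->.
(* The first summand is in [W], the second on the line; the corrected vector is orthogonal to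
   both. *)
have -> : br d x = br d0 x + br b x.
  by rewrite /d /d1 !linearDl linearZl_LR /= a_center scaler0 addr0.
rewrite linearDr /= hw ?add0r; last first.
  by apply/memv_imgP; exists x; [exact/UP|rewrite lfunE].
rewrite form_sym; apply: (@line_form _ _ form a).
  by apply: (@br_line _ _ _ form).
by rewrite linearBl /= lc_orth // br_orth // subrr.
Qed.

End ChooseDual.

Lemma bi_nilpotent_abelian (R : realType) (B : vectType R)
    (brB prB : {bilinear B -> B -> B}) :
  is_abelian brB -> is_comm_assoc prB ->
  (forall x, nilpotent_map (prB x)) -> bi_nilpotent brB prB.
Proof.
move=> brB0 ca nil; split => //; first exact: lie_abelian.
exists 1%N; apply/eqP; rewrite -subv0; apply/span_subvP => z.
by case/allpairsP => -[x y] [_ _ ->]; rewrite brB0 mem0v.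
Qed.

(** * Reading off the parameters of the double extension *)

Section Reduction.
Variables (R : realType) (g : vectType R) (br pr : {bilinear g -> g -> g}).
Variables (form : {symmetric g}) (a d : g).
Hypotheses (br_lie : is_lie_algebra br) (br_nil : is_nilpotent_lie br).
Hypotheses (form_nd : nondegenerate form) (form_lor : lorentzian form).
Hypotheses (form_flat : flat br form) (aN0 : a != 0) (aa : form a a = 0).
Hypotheses (a_ker : lc_kernel br form a) (a_center : lie_center br a).
Hypotheses (pr_ca : is_comm_assoc pr).
Hypotheses (pr_nil : forall x, nilpotent_map (pr x)).
Hypotheses (pr_inv : forall x y z, form (pr x y) z = form x (pr y z)).
Hypotheses (pr_hm : hertling_manin br pr).
Hypotheses (a_ideal : two_sided_ideal pr <[a]>%VS).
Hypotheses (ad : form a d = 1) (dd : form d d = 0).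
Local Notation m := (levi_civita br form).
Local Notation h x := (form x a = 0).
Hypothesis d_orth : forall x, h x -> form (m d d) (br d x) = 0.

Variables (B : vectType R) (iota : {linear B -> g}) (pi : {linear g -> B}).
Hypotheses (iotaK : cancel iota pi) (iota_a : forall x, h (iota x)).
Hypotheses (iota_d : forall x, form (iota x) d = 0).
Hypotheses (pi_a : pi a = 0) (pi_d : pi d = 0).
Hypothesis decomp : forall X, X = form X d *: a + iota (pi X) + form X a *: d.

Let prC x y : pr x y = pr y x := prod_comm pr_ca x y.
Let brC x y : br x y = - br y x.
Proof.
apply/eqP; rewrite -addr_eq0; apply/eqP.
by have := lie_alternating br_lie (x + y); rewrite linearDl !linearDr /=
      !(lie_alternating br_lie) add0r addr0.
Qed.

(** The ideal property makes [a] an eigenvector of [pr x], and nilpotency forces the eigenvalue to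
    be 0. This is why [lambda] vanishes. *)
Let pr_ar x : pr x a = 0.
Proof.
have /vlineP[k xa] : pr x a \in <[a]>%VS by have [] := a_ideal x (memv_line a).
have [n /(_ a)] := pr_nil x.
have -> : iter n (pr x) a = k ^+ n *: a.
  elim: n => [|n IH]; first by rewrite expr0 scale1r.
  by rewrite iterS IH linearZr_LR /= xa scalerA exprSr.
move/eqP; rewrite scaler_eq0 (negPf aN0) orbF expf_eq0 => /andP[_ /eqP k0].
by rewrite xa k0 scale0r.
Qed.
Let pr_al x : pr a x = 0. Proof. by rewrite prC pr_ar. Qed.
Let pr_orth x y : h (pr x y). Proof. by rewrite pr_inv pr_ar linear0r. Qed.
Let br_al x : br a x = 0. Proof. exact: a_center. Qed.
Let br_ar x : br x a = 0. Proof. by rewrite brC br_al oppr0. Qed.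
Let da : form d a = 1. Proof. by rewrite form_sym. Qed.

Let T c x := c *: a + iota x.
Local Notation formB := (pull_form iota form).
Local Notation prB := (pull_mul iota pi pr).
Local Notation D := (pi \o br d \o iota).
Local Notation v := (pi \o pr d \o iota).
Local Notation a0 := (pi (pr d d)).
Local Notation b0 := (pi (m d d)).
Local Notation beta := (form (pr d d) d).

Let TE X : h X -> X = T (form X d) (pi X).
Proof. by move=> hX; rewrite {1}(decomp X) hX scale0r addr0. Qed.
Let pi_T c x : pi (T c x) = x.
Proof. by rewrite /T linearD linearZ /= pi_a scaler0 add0r iotaK. Qed.
Let T_d c x : form (T c x) d = c.
Proof. by rewrite /T linearDl linearZl_LR /= ad iota_d mulr1 addr0. Qed.
Let T_orth c x : h (T c x).
Proof. by rewrite /T linearDl linearZl_LR /= aa iota_a mulr0 addr0. Qed.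
Let T_eq X c x : h X -> form X d = c -> pi X = x -> X = T c x.
Proof. by move=> hX <- <-; exact: TE. Qed.
Let brT c x Y : br (T c x) Y = br (iota x) Y.
Proof. by rewrite /T linearDl linearZl_LR /= br_al scaler0 add0r. Qed.
Let brTr c x Y : br Y (T c x) = br Y (iota x).
Proof. by rewrite /T linearDr linearZr_LR /= br_ar scaler0 add0r. Qed.
Let prT c x Y : pr (T c x) Y = pr (iota x) Y.
Proof. by rewrite /T linearDl linearZl_LR /= pr_al scaler0 add0r. Qed.
Let prTr c x Y : pr Y (T c x) = pr Y (iota x).
Proof. by rewrite prC prT prC. Qed.

Let formB_pi X y : h X -> formB (pi X) y = form X (iota y).
Proof.
move=> hX; rewrite /pull_form [in RHS](TE hX) /T linearDl linearZl_LR /=.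
by rewrite [form a _]form_sym iota_a mulr0 add0r.
Qed.

Let line_orth X Y : X \in <[a]>%VS -> h Y -> form X Y = 0.
Proof. exact: line_form. Qed.
Let pi_line X : X \in <[a]>%VS -> pi X = 0.
Proof. by case/vlineP=> k ->; rewrite linearZ /= pi_a scaler0. Qed.
Let lc_d_line x : h x -> m d x \in <[a]>%VS.
Proof. exact: lc_left_line. Qed.

Let hm_lc : is_levi_civita br form m := levi_civitaP form_nd br_lie.

(** Skewness makes [m (iota x) d] orthogonal to [d] and moves [m d] from [iota x] onto [d]; hence
    the choice of [b0] as the projection of [m d d]. *)
Let br_d_d x : form (br d (iota x)) d = - formB b0 x.
Proof.
rewrite formB_pi; last exact: lc_orth.
rewrite (lc_torsion_free hm_lc) linearBl /= [form (m d d) _]form_sym.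
have e1 := lc_skew br_lie form_nd d (iota x) d.
have := lc_skew br_lie form_nd (iota x) d d; rewrite [form d _]form_sym; lra.
Qed.

Lemma reduction_table : dext_table prB formB beta a0 b0 D v br pr T d.
Proof.
have br_h x y : h (br x y) by exact: br_orth.
split.
- by move=> c x c' x'; rewrite /T linearD; module_ring.
- by move=> k c x; rewrite /T linearZ /=; module_ring.
- by rewrite /T scale0r linear0 addr0.
- move=> c x c' y; rewrite brT brTr; apply: T_eq => //; last first.
    by apply/pi_line; apply: (@br_line _ _ _ form).
  have fsym u w : formB u w = formB w u by exact: form_sym.
  rewrite /dext_omega /= [pull_form _ _ x _]fsym !formB_pi //.
  (* Since [m d (iota x)] is on the line, its pairing with [iota y] is 0; Koszul's formula then
     expresses the [a]-component of [br (iota x) (iota y)] through [D]. *)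
  have := line_orth (lc_d_line (iota_a x)) (iota_a y).
  rewrite (levi_civita_koszul hm_lc) (brC (iota y) d) (brC (iota y)) !linearNl /=.
  lra.
- by move=> c x; rewrite brTr; apply: T_eq => //; exact: br_d_d.
- move=> c x; rewrite brT brC; apply: T_eq; last by rewrite linearN.
    by rewrite linearNl /= br_h oppr0.
  by rewrite linearNl /= br_d_d opprK.
- exact: lie_alternating.
- move=> c x c' y; rewrite prT prTr; apply: T_eq => //.
  by rewrite /= formB_pi // [RHS]pr_inv form_sym.
- move=> c x; rewrite prTr; apply: T_eq => //.
  by rewrite /= formB_pi // [LHS]form_sym -pr_inv.
- move=> c x; rewrite prT prC; apply: T_eq => //.
  by rewrite /= formB_pi // [LHS]form_sym -pr_inv.
- exact: TE.
Qed.

Let tab := reduction_table.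
Let T_inj c x c' x' : T c x = T c' x' -> c = c' /\ x = x'.
Proof.
move=> e; split; first by rewrite -(T_d c x) e T_d.
by rewrite -(pi_T c x) e pi_T.
Qed.
Let form_T c x c' y : form (T c x) (T c' y) = formB x y.
Proof.
rewrite /T !linearDl !linearDr !linearZl_LR !linearZr_LR /= aa iota_a.
by rewrite [form a _]form_sym iota_a !mulr0 !add0r.
Qed.
Let T_span X : exists s x t, X = T s x + t *: d.
Proof. by exists (form X d), (pi X), (form X a); exact: decomp. Qed.

(** This and the next four lemmas extract components, in the table, of commutativity, associativity
    and invariance in the large algebra. *)
Lemma reduction_comm_assoc : is_comm_assoc prB.
Proof.
split=> [x y|x y z]; first by rewrite /= /pull_mul prC.
have := prod_assoc pr_ca (T 0 x) (T 0 y) (T 0 z).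
by rewrite !(pr_bb tab) => /T_inj[].
Qed.

Lemma reduction_inv x y z : formB (prB x y) z = formB x (prB y z).
Proof.
have := pr_inv (T 0 x) (T 0 y) (T 0 z).
by rewrite !(pr_bb tab) !form_T.
Qed.

Lemma reduction_v_sym x y : formB (v x) y = formB x (v y).
Proof.
have := prC (T 0 x) (T 0 y); rewrite !(pr_bb tab) => /T_inj[-> _].
exact: form_sym.
Qed.

Lemma reduction_v_prod x y : v (prB x y) = prB (v x) y.
Proof.
have := prod_assoc pr_ca d (T 0 x) (T 0 y).
by rewrite (pr_bb tab) !(pr_db tab) (pr_bb tab) => /T_inj[_ <-].
Qed.

Lemma reduction_v_sqr x : v (v x) = prB x a0.
Proof.
have e := prod_assoc pr_ca (T 0 x) d d.
rewrite (pr_dd tab) (pr_bb tab) !(pr_bd tab) in e.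
by case: (T_inj e).
Qed.

(** Modulo the line, bracketing with [d] is minus right multiplication by [d], which has square zero
    by [lc_right_sqr_line]. *)
Lemma reduction_D_sqr x : D (D x) = 0.
Proof.
have line_br X Y : X - Y \in <[a]>%VS -> br d X = br d Y.
  case/vlineP => k e; have -> : X = k *: a + Y by rewrite -e subrK.
  by rewrite linearDr linearZr_LR /= br_ar scaler0 add0r.
have h_br X : h (br d X) by exact: br_orth.
have h_m X : h (m X d) by exact: lc_orth.
have e1 X : h X -> br d X + m X d \in <[a]>%VS.
  by move=> hX; apply: (@br_lc_line _ _ _ form).
(* The projection inside [D (D x)] only drops a multiple of [a], which [br d] kills, so it can be
   removed. *)
rewrite /= -(brTr (form (br d (iota x)) d)) -TE //; apply: pi_line.
have e2 : br d (iota x) - - m (iota x) d \in <[a]>%VS by rewrite opprK e1.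
have e3 : m (m (iota x) d) d \in <[a]>%VS by exact: lc_right_sqr_line.
have e4 := e1 _ (h_br (iota x)).
have e5 : m (br d (iota x)) d = - m (m (iota x) d) d.
  rewrite (line_l br_lie form_nd a_ker d e2) -scaleN1r lcZl // scaleN1r //.
by have := memvD e4 e3; rewrite e5 addrNK.
Qed.

Lemma reduction_D_orth x : formB b0 (D x) = 0.
Proof.
have hm_dd : h (m d d) by exact: lc_orth.
have h_br : h (br d (iota x)) by exact: br_orth.
rewrite formB_pi // /= -[RHS](d_orth (iota_a x)) [in RHS](TE h_br).
rewrite /T linearDr linearZr_LR /= hm_dd mulr0 add0r //.
Qed.

Lemma reduction_riemannian : riemannian formB.
Proof.
move=> x xN0; have ge0 : 0 <= formB x x.
  exact: lorentzian_orth_ge0 (iota_a x).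
rewrite lt_neqAle ge0 andbT eq_sym; apply: contra_neq xN0 => xx.
have : iota x \in <[a]>%VS by apply: (null_line form_lor).
by move/pi_line; rewrite iotaK.
Qed.

Lemma reduction_nondegenerate : nondegenerate formB.
Proof.
apply: nondegenerateI => x hx; apply: contrapT => /eqP /reduction_riemannian.
by rewrite hx ltxx.
Qed.

Lemma reduction_nilpotent x : nilpotent_map (prB x).
Proof.
have [n hn] := pr_nil (T 0 x); exists n => y.
(* The [a]-coefficient changes at each step but has no influence on later products. *)
have [c e] : exists c, iter n (pr (T 0 x)) (T 0 y) = T c (iter n (prB x) y).
  elim: n {hn} => [|n [c IH]]; first by exists 0.
  by rewrite !iterS IH (pr_bb tab); eexists.
by rewrite -(pi_T c (iter _ _ _)) -e hn linear0.
Qed.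

Definition reduction_coord (X : g) : dext B := (form X d, pi X, form X a).
Fact reduction_coord_linear : linear reduction_coord.
Proof.
by move=> k X Y; rewrite /reduction_coord !linearPl linearP /= dextZ dextD.
Qed.
HB.instance Definition _ := GRing.isLinear.Build R g (dext B) *:%R
  reduction_coord reduction_coord_linear.

Lemma reduction_special :
  is_special_dext br pr (@zero_bilinear R B) prB formB beta a0 b0 D v.
Proof.
have brB0 : is_abelian (@zero_bilinear R B) by [].
have nd := reduction_nondegenerate; have ca := reduction_comm_assoc.
split => //.
- split; last exact: reduction_riemannian.
  split=> //.
  + exact: lie_abelian.
  + by move=> x y z; rewrite !(levi_civita_abelian brB0 nd).
  + exact: reduction_inv.
  + move=> x y z w; rewrite /= /zero_bilinear.
    by rewrite !linear0r !linear0l !subr0 !addr0.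
- exact: bi_nilpotent_abelian reduction_nilpotent.
- apply: (special_admissible brB0 nd tab ca).
  + exact: reduction_inv.
  + exact: reduction_v_sym.
  + exact: reduction_v_prod.
  + exact: reduction_v_sqr.
  + by move=> c x e; apply: T_inj; rewrite e (tab0 tab).
  + exact: reduction_D_sqr.
  + exact: pr_hm.
- exact: reduction_D_sqr.
- move=> _ [x _ <-] z /vlineP[k ->]; rewrite linearZl_LR /=.
  by rewrite reduction_D_orth mulr0.
have coordT c x : reduction_coord (T c x) = (c, x, 0).
  by rewrite /reduction_coord T_d pi_T T_orth.
have coordd : reduction_coord d = (0, 0, 1).
  by rewrite /reduction_coord dd pi_d da.
have coordE s x t : reduction_coord (T s x + t *: d) = (s, x, t).
  rewrite linearD linearZ /= coordT coordd dextZ dextD.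
  by rewrite mulr0 scaler0 mulr1 !addr0 add0r.
move=> p; exists reduction_coord.
  exists (fun Y => T Y.1.1 Y.1.2 + Y.2 *: d) => [X|[[s x] t]]; last exact: coordE.
  by rewrite /= -decomp.
(* Source and target obey the same table, so the coordinate map is a morphism. *)
have dtab := dext_tableP prB beta a0 b0 D v brB0 nd.
exact: table_morphism tab dtab coordT coordd T_span.
Qed.

End Reduction.

Lemma special_dext_of_lorentzian (R : realType) (g : vectType R)
    (br pr : {bilinear g -> g -> g}) (form : {symmetric g}) (ahat : g) :
  bi_nilpotent br pr -> weakly_flat_lorentzian_F_lie br pr form ->
  ahat != 0 -> (lc_kernel br form `&` lie_center br) ahat ->
  form ahat ahat = 0 -> two_sided_ideal pr <[ahat]>%VS ->
  exists (B : vectType R) (brB prB : {bilinear B -> B -> B})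
         (formB : {symmetric B}) (beta : R) (a0 b0 : B) (D v : {linear B -> B}),
    is_special_dext br pr brB prB formB beta a0 b0 D v.
Proof.
move=> [_ nil _ prnil] [[lie nd fl ca inv hm] lor] aN0 [aker acen] aa ideal.
have [d [ad dd d_orth]] := exists_dual_vector lie nil nd lor fl aN0 aa aker acen.
have [B [iota [pi [iotaK ia idd [pia pid] decomp]]]] := hyperbolic_splitting aa dd ad.
do 9!eexists; exact: (reduction_special lie nil nd lor fl aN0 aa aker acen
  ca prnil inv hm ideal ad dd d_orth iotaK ia idd pia pid decomp).
Qed.

Lemma lorentzian_of_orthogonal_seq (R : realType) (g : vectType R)
    (form : {symmetric g}) (e : seq g) :
  <<e>>%VS = fullv -> (0 < size e)%N ->
  (forall i j, (i < size e)%N -> (j < size e)%N -> i != j -> form e`_i e`_j = 0) ->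
  form e`_0 e`_0 < 0 ->
  (forall i, (0 < i < size e)%N -> 0 < form e`_i e`_i) -> lorentzian form.
Proof.
move=> spe e_gt0 orth neg pos.
have e_free : free (in_tuple e).
  apply/freeP => k sum0 i; have := congr1 (form ^~ e`_i) sum0.
  rewrite linear0l linear_sumlz (bigD1 i) //= linearZl_LR big1 => [/=|j ji].
    rewrite addr0 => /eqP; rewrite mulf_eq0 => /orP[/eqP//|].
    case: (posnP i) => [->|i_gt0]; first by rewrite lt_eqF.
    by rewrite gt_eqF // pos // i_gt0 /=.
  by rewrite linearZl_LR /= orth ?mulr0.
have e_basis : basis_of fullv e by rewrite /basis_of spe eqxx.
(* The predecessor in the signature is harmless since [e] is non-empty. *)
have se : size e == (1 + (\dim {:g}).-1)%N.
  by rewrite (size_basis (X := in_tuple e) e_basis) add1n prednK // -(size_basis (X := in_tuple e) e_basis).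
exists (Tuple se); split => //.
- move=> i j ij; rewrite !(tnth_nth 0) /=; apply: orth; rewrite ?(eqP se) //.
- move=> i; rewrite ltnS leqn0 (tnth_nth 0) => /eqP -> //.
- by move=> i i_gt0; rewrite (tnth_nth 0) /=; apply: pos; rewrite i_gt0 (eqP se) ltn_ord.
Qed.

(** * From double extensions to Lorentzian algebras *)

Section Converse.
Variables (R : realType) (g B : vectType R) (br pr : {bilinear g -> g -> g}).
Variables (brB prB : {bilinear B -> B -> B}) (formB : {symmetric B}).
Variables (beta : R) (a0 b0 : B) (D v : {linear B -> B}).
Local Notation p := (DextParam 0 0 beta a0 b0 D D v).
Local Notation dbr := (dext_br brB formB p).
Local Notation dpr := (dext_pr prB formB p).
Local Notation dform := (dext_form formB).
Local Notation dd := ((0, 0, 1) : dext B).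

Hypotheses (br_lie : is_lie_algebra br) (pr_ca : is_comm_assoc pr).
Hypotheses (base : weakly_flat_riemannian_F_lie brB prB formB).
Hypotheses (brB0 : is_abelian brB) (adm : dext_admissible brB prB formB p).
Hypotheses (D_sqr : forall x, D (D x) = 0) (b0D : forall x, formB b0 (D x) = 0).
Variables (phi : {linear g -> dext B}) (psi : dext B -> g).
Hypotheses (phiK : cancel phi psi) (psiK : cancel psi phi).
Hypothesis phi_br : forall x y, phi (br x y) = dbr (phi x) (phi y).
Hypothesis phi_pr : forall x y, phi (pr x y) = dpr (phi x) (phi y).

Let nd : nondegenerate formB. Proof. by case: base => -[]. Qed.
Let caB : is_comm_assoc prB. Proof. by case: base => -[]. Qed.
Let invB x y z : formB (prB x y) z = formB x (prB y z).
Proof. by case: base => -[]. Qed.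
Let pos x : x != 0 -> 0 < formB x x. Proof. by case: base => _; apply. Qed.
Let v_prod x y : v (prB x y) = prB (v x) y. Proof. exact: (da_v adm). Qed.
Let v_sym x y : formB (v x) y = formB x (v y).
Proof. by rewrite (adjointP nd) (da_v_selfadjoint adm). Qed.
Let v_sqr x : v (v x) = prB x a0.
Proof. by rewrite (da_v2 adm) /= scale0r add0r. Qed.
Let tab := dext_tableP prB beta a0 b0 D v brB0 nd.
Let fsym x y : formB x y = formB y x := form_sym formB x y.
Let phi_inj : injective phi := can_inj phiK.

Definition converse_form : {symmetric g} := pull_form phi dform.
Local Notation form := converse_form.

Let formE x y : form x y = dform (phi x) (phi y). Proof. by []. Qed.

Lemma converse_nondegenerate : nondegenerate form.
Proof.
apply: nondegenerateI => X hX; apply: phi_inj; rewrite linear0.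
have h Y : dform (phi X) Y = 0 by rewrite -(psiK Y) -formE hX.
move: (h (1, 0, 0)) (h (0, 0, 1)) (fun y => h (0, y, 0)).
case: (phi X) => [[s x] t] /=; rewrite ?linear0r ?mulr1 ?mulr0 ?addr0 ?add0r.
move=> -> -> hx; rewrite (nondegenerateE nd (x := x)) // => y.
by move: (hx y); rewrite ?linear0r ?mulr0 ?add0r.
Qed.

Lemma converse_pr_inv x y z : form (pr x y) z = form x (pr y z).
Proof.
rewrite !formE !phi_pr; case: (phi x) (phi y) (phi z) => [[s1 x1] t1] [[s2 x2] t2] [[s3 x3] t3].
by rewrite /= !linE /= invB !v_sym [formB x1 a0]fsym; ring.
Qed.

Lemma converse_hertling_manin : hertling_manin br pr.
Proof.
move=> x y z w; apply: phi_inj; rewrite linear0.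
have prC X Y : dpr X Y = dpr Y X.
  by rewrite -(psiK X) -(psiK Y) -!phi_pr (prod_comm pr_ca).
have span X : exists s x t, X = ((s, x, 0) : dext B) + t *: dd.
  case: X => [[s b] t]; exists s, b, t.
  by rewrite dextZ dextD mulr0 scaler0 mulr1 !addr0 add0r.
have := special_hertling_manin brB0 nd tab caB invB v_sym v_prod v_sqr span prC adm.
move/(_ (phi x) (phi y) (phi z) (phi w)) => <-.
have phiB X Y : phi (X - Y) = phi X - phi Y by exact: linearB.
have phiD X Y : phi (X + Y) = phi X + phi Y by exact: linearD.
by rewrite /hm_tensor !(phiB, phiD) !(phi_br, phi_pr).
Qed.

(** Closed form of the Levi-Civita product [*] of the double extension: [x * y = form (D x) y] times
    [a], [x * d = - D x], [d * y = - form b0 y] times [a], [d * d = b0], and [a] annihilates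
    everything. *)
Definition dext_lc (X Y : dext B) : dext B :=
  (formB (D X.1.2) Y.1.2 - X.2 * formB b0 Y.1.2,
   (X.2 * Y.2) *: b0 - Y.2 *: D X.1.2, 0).

Lemma converse_levi_civita :
  is_levi_civita br form (fun X Y => psi (dext_lc (phi X) (phi Y))).
Proof.
split.
- move=> Y k X X'; apply: phi_inj; rewrite !linearP !psiK /dext_lc.
  case: (phi X) (phi X') (phi Y) => [[s1 x1] t1] [[s2 x2] t2] [[s3 x3] t3].
  rewrite !(dextZ, dextD) /= !linearP /=; apply: dext_eq; rewrite ?linE /= ?scale_regular;
    try ring; module_ring.
- move=> Y k X X'; apply: phi_inj; rewrite !linearP !psiK /dext_lc.
  case: (phi X) (phi X') (phi Y) => [[s1 x1] t1] [[s2 x2] t2] [[s3 x3] t3].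
  rewrite !(dextZ, dextD) /=; apply: dext_eq; rewrite ?linE /= ?scale_regular;
    try ring; module_ring.
- move=> X Y; apply: phi_inj; rewrite phi_br linearB !psiK /dext_lc.
  case: (phi X) (phi Y) => [[s1 x1] t1] [[s2 x2] t2].
  rewrite /= dextN dextD; apply: dext_eq; last by rewrite subr0.
    rewrite linearBl /= (form_adjointl nd) [formB (D x2) x1]fsym; ring.
  rewrite brB0; module_ring.
move=> X Y Z; rewrite !formE !psiK /dext_lc.
case: (phi X) (phi Y) (phi Z) => [[s1 x1] t1] [[s2 x2] t2] [[s3 x3] t3].
rewrite /= !linE /= ![formB x2 _]fsym; ring.
Qed.

(** Uniqueness identifies the product with [dext_lc]. Since [D (D x) = 0] and [b0] is orthogonal to
    the image of [D], the terms of its associator that are not symmetric in [X] and [Y] vanish;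
    those in [D b0] survive and are symmetric. *)
Lemma converse_flat : flat br form.
Proof.
rewrite /flat (levi_civita_unique converse_nondegenerate
  (levi_civitaP converse_nondegenerate br_lie) converse_levi_civita).
move=> X Y Z; rewrite !psiK; apply: phi_inj; rewrite !linearB !psiK /dext_lc /=.
case: (phi X) (phi Y) (phi Z) => [[s1 x1] t1] [[s2 x2] t2] [[s3 x3] t3].
have D_b0 k l x : D (k *: b0 - l *: D x) = k *: D b0.
  by rewrite linearB linearZ [D (l *: _)]linearZ /= D_sqr scaler0 subr0.
rewrite !(dextN, dextD) /= !D_b0; apply: dext_eq.
- rewrite ?(linE, b0D) /= ![formB (D _) b0]fsym !b0D [formB (D x2) (D x1)]fsym.
  ring.
- module_ring.
- by [].
Qed.

Let psi_linear : linear psi.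
Proof. by move=> k X Y; apply: phi_inj; rewrite linearP !psiK. Qed.

Lemma converse_lorentzian : lorentzian form.
Proof.
have psiD X Y : psi (X + Y) = psi X + psi Y.
  by have := psi_linear 1 X Y; rewrite !scale1r.
have psi0 : psi 0 = 0 by rewrite -(linear0 phi) phiK.
have psiZ k X : psi (k *: X) = k *: psi X.
  by have := psi_linear k X 0; rewrite psi0 !addr0.
have aniso z : formB z z = 0 -> z = 0.
  by move=> zz; apply: contrapT => /eqP /pos; rewrite zz ltxx.
have [Y [sY spY oY]] := gram_schmidt (vbasis {:B}) aniso.
rewrite (span_basis (vbasisP _)) in spY.
pose f (y : B) := psi (0, y, 0).
have f_lin : linear f.
  by move=> k x y; rewrite /f -psi_linear dextZ dextD mulr0 addr0.
pose fL := HB.pack_for {linear B -> g} f (GRing.isLinear.Build R B g *:%R f f_lin).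
(* The vectors [a - d] and [a + d] have squares -2 and 2 and span the hyperbolic plane; an
   orthogonal basis of [B] completes them. *)
pose e := [:: psi (1, 0, -1), psi (1, 0, 1) & [seq fL y | y <- Y]].
have E X Z : form (psi X) (psi Z) = dform X Z by rewrite formE !psiK.
have nthE k : (k < size Y)%N -> e`_k.+2 = psi (0, Y`_k, 0).
  by move=> kY; rewrite /e /= (nth_map 0).
have se : size e = (size Y).+2 by rewrite /= size_map.
apply: (@lorentzian_of_orthogonal_seq _ _ _ e) => //.
- apply/eqP; rewrite eqEsubv subvf; apply/subvP => X _.
  have -> : X = ((phi X).1.1 - (phi X).2) / 2 *: psi (1, 0, -1)
     + (((phi X).1.1 + (phi X).2) / 2 *: psi (1, 0, 1) + f (phi X).1.2).
    rewrite /f -!psiZ -!psiD; apply: phi_inj; rewrite psiK.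
    case: (phi X) => [[s x] t] /=; rewrite !(dextZ, dextD); apply: dext_eq.
    + by rewrite /= scale_regular; field.
    + by rewrite /= !scaler0 !add0r.
    + by rewrite /= scale_regular; field.
  rewrite !span_cons; apply: memv_add; first by rewrite memvZ // memv_line.
  apply: memv_add; first by rewrite memvZ // memv_line.
  have -> : [seq fL y | y <- Y] = [seq linfun fL y | y <- Y].
    by apply: eq_map => y; rewrite lfunE.
  rewrite -limg_span spY; apply/memv_imgP; exists (phi X).1.2; first exact: memvf.
  by rewrite lfunE.
- rewrite se; case=> [|[|i]] [|[|j]] //; rewrite !ltnS => iY jY ij;
    rewrite ?nthE ?E //= ?linear0l ?linear0r; try ring.
  rewrite oY //; ring.
- rewrite E /= linear0l; lra.
case=> [|[|i]] // iY; first by rewrite E /= linear0l; lra.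
rewrite se !ltnS in iY; rewrite nthE // E /= !mul0r !add0r; apply: pos.
(* [Y] spans [B] and has as many entries as a basis, so none of them is zero. *)
have Y_free : free Y by rewrite /free spY sY size_tuple.
by apply: (free_not0 Y_free); exact: mem_nth.
Qed.

Lemma converse_weakly_flat : weakly_flat_lorentzian_F_lie br pr form.
Proof.
split; last exact: converse_lorentzian.
split=> //; [exact: converse_nondegenerate | exact: converse_flat
  | exact: converse_pr_inv | exact: converse_hertling_manin].
Qed.

(** With [mu] and [lambda] zero, neither the bracket nor the product sees the [a]-coordinate, and
    [dext_lc] ignores that of its left argument. *)
Lemma converse_ahat : let a := psi (1, 0, 0) in
  [/\ a != 0, (lc_kernel br form `&` lie_center br) a, form a a = 0
    & two_sided_ideal pr <[a]>%VS].
Proof.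
move=> a; have phia : phi a = (1, 0, 0) by rewrite psiK.
have pra x : pr x a = 0.
  apply: phi_inj; rewrite phi_pr phia linear0; case: (phi x) => [[s b] t].
  rewrite dext0; apply: dext_eq; rewrite ?linear0r ?(linear0 v);
    by rewrite ?(mulr0, mul0r, scaler0, scale0r, addr0).
split.
- apply/eqP => a0E; move: phia; rewrite a0E linear0 => -[/eqP].
  by rewrite eq_sym oner_eq0.
- split=> y; last first.
    apply: phi_inj; rewrite phi_br phia linear0; case: (phi y) => [[s b] t].
    rewrite dext0; apply: dext_eq => //.
      rewrite /= linearBl /= (form_adjointl nd) (linear0 D) !linear0l linear0r.
      by ring.
    by rewrite /= brB0 (linear0 D) scaler0 scale0r subrr addr0.
  rewrite (levi_civita_unique converse_nondegenerate
    (levi_civitaP converse_nondegenerate br_lie) converse_levi_civita).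
  apply: phi_inj; rewrite psiK phia linear0 /dext_lc dext0 /=.
  by rewrite (linear0 D) linear0l !mul0r scale0r scaler0 !subrr.
- by rewrite formE phia /= linear0l; ring.
- move=> x y /vlineP[k ->]; rewrite (prod_comm pr_ca (k *: a)) linearZr_LR /= pra.
  by rewrite scaler0 mem0v.
Qed.

End Converse.

(** Multiplication by [d] is nilpotent and acts on [B], modulo [a], as [v]. *)
Lemma special_dext_nilpotent (R : realType) (g : vectType R)
    (br pr : {bilinear g -> g -> g}) (B : vectType R)
    (brB prB : {bilinear B -> B -> B}) (formB : {symmetric B}) (beta : R)
    (a0 b0 : B) (D v : {linear B -> B}) :
  bi_nilpotent br pr ->
  is_special_dext br pr brB prB formB beta a0 b0 D v -> nilpotent_map v.
Proof.
move=> [_ _ _ pr_nil] [[[_ nd _ _ _ _] _] brB0 _ _ _ _ [phi [psi phiK psiK] iso]].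
have tab := dext_tableP prB beta a0 b0 D v brB0 nd.
have [n hn] := pr_nil (psi (0, 0, 1)); exists n => x.
have [c e] : exists c, phi (iter n (pr (psi (0, 0, 1))) (psi (0, x, 0))) =
    (c, iter n v x, 0).
  elim: n {hn} => [|n [c IH]]; first by exists 0; rewrite psiK.
  rewrite !iterS (iso _ _).2 psiK IH (pr_db tab); by eexists.
by move: e; rewrite hn linear0 => -[].
Qed.

Unset Implicit Arguments.

Theorem theorem3p14 (R : realType) (g : vectType R)
    (br pr : {bilinear g -> g -> g}) :
  bi_nilpotent br pr -> ~ is_abelian br ->
  ((exists form : {symmetric g},
      weakly_flat_lorentzian_F_lie br pr form /\
      exists ahat : g,
        [/\ ahat != 0, (lc_kernel br form `&` lie_center br) ahat,
            form ahat ahat = 0 & two_sided_ideal pr <[ahat]>%VS])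
   <->
   (exists (B : vectType R) (brB prB : {bilinear B -> B -> B})
           (formB : {symmetric B}) (beta : R) (a0 b0 : B)
           (D v : {linear B -> B}),
      is_special_dext br pr brB prB formB beta a0 b0 D v))
  /\
  (forall (B : vectType R) (brB prB : {bilinear B -> B -> B})
          (formB : {symmetric B}) (beta : R) (a0 b0 : B)
          (D v : {linear B -> B}),
     is_special_dext br pr brB prB formB beta a0 b0 D v -> nilpotent_map v).
Proof.
move=> bn _; split; last first.
  by move=> B brB prB formB beta a0 b0 D v; exact: special_dext_nilpotent bn.
split=> [[form [wf [ahat [aN0 aK aa ideal]]]]|].
  exact: (special_dext_of_lorentzian bn wf aN0 aK aa ideal).
move=> [B [brB [prB [formB [beta [a0 [b0 [D [v sd]]]]]]]]].
case: sd => base brB0 _ adm DD imD [phi [psi phiK psiK] iso].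
have [lie _ ca _] := bn.
have b0D x : formB b0 (D x) = 0.
  by apply: (imD (D x)); [exists x | exact: memv_line].
have phi_br x y := (iso x y).1; have phi_pr x y := (iso x y).2.
exists (converse_form formB phi); split.
  exact: (converse_weakly_flat lie ca base brB0 adm DD b0D phiK psiK phi_br phi_pr).
exists (psi (1, 0, 0)).
exact: (converse_ahat lie ca base brB0 phiK psiK phi_br phi_pr).
Qed.
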